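(* Let $\alpha\in\mathbb C\setminus\{-1,-2,\dots\}$ and let $\mathcal F=(F_1,F_2)$ be a pair of finite (possibly empty) sets of positive integers; let $k_i$ be the number of elements of $F_i$ ($i=1,2$) and $k=k_1+k_2$. Then there exists $r>0$ such that $$\int_{\Lambda_r} L_{n+u_{\mathcal F}}^{\alpha;\mathcal F}(z)\,L_{m+u_{\mathcal F}}^{\alpha;\mathcal F}(z)\,\frac{z^{\alpha+k}e^{-z}}{\Omega_{\mathcal F}^{\alpha}(z)^2}\,dz=(e^{2\pi\alpha i}-1)\,\frac{\Gamma(n+\alpha+1)\prod_{f\in F_1}(n-f)\prod_{f\in F_2}(n+\alpha+f+1)}{n!}\,\delta_{n,m}$$ for all nonnegative integers $n,m\notin F_1$.
   Context: For $\alpha\in\mathbb C\setminus\{-1,-2,\dots\}$ and $n\in\{0,1,2,\dots\}$, the Laguerre polynomials are $L_n^{\alpha}(x)=\sum_{j=0}^n\frac{(-x)^j}{j!}\binom{n+\alpha}{n-j}$. For a pair $\mathcal F=(F_1,F_2)$ put $$u_{\mathcal F}=\sum_{f\in F_1}f+\sum_{f\in F_2}f-\binom{k_1+1}{2}-\binom{k_2}{2}.$$ Polynomial $\Omega^\alpha_{\mathcal F}$: $\Omega_{\mathcal F}^{\alpha}(x)$ is the determinant of the $k\times k$ matrix whose first $k_1$ rows are, for $f\in F_1$ (in increasing order), $\bigl(L_f^{\alpha}(x),(L_f^{\alpha})'(x),\dots,(L_f^{\alpha})^{(k-1)}(x)\bigr)$, and whose last $k_2$ rows are, for $f\in F_2$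 (in increasing order), $\bigl(L_f^{\alpha}(-x),L_f^{\alpha+1}(-x),\dots,L_f^{\alpha+k-1}(-x)\bigr)$. (If $k=0$ the determinant is $1$.) Exceptional Laguerre polynomials: for a nonnegative integer $n\notin F_1$, $L_{n+u_{\mathcal F}}^{\alpha;\mathcal F}(x)$ is the determinant of the $(k+1)\times(k+1)$ matrix whose first row is $\bigl(L_n^{\alpha}(x),(L_n^{\alpha})'(x),\dots,(L_n^{\alpha})^{(k)}(x)\bigr)$, whose next $k_1$ rows are, for $f\in F_1$ (in increasing order), $\bigl(L_f^{\alpha}(x),(L_f^{\alpha})'(x),\dots,(L_f^{\alpha})^{(k)}(x)\bigr)$, and whose last $k_2$ rows are, for $f\in F_2$ (in increasing order), $\bigl(L_f^{\alpha}(-x),L_f^{\alpha+1}(-x),\dots,L_f^{\alpha+k}(-x)\bigr)$. Path: for $r>0$, $\Lambda_r$ is the positively oriented path formed by the two half lines $\{x\pm ri: x\in[0,+\infty)\}$ and the left half of the circle with center $0$ and radius $r$ joining them; that is, it is traversed from $+\infty+ir$ to $ir$, then along the semicircle $|z|=r$, $\Re z\le 0$, from $ir$ to $-ir$, then from $-ir$ to $+\infty-ir$. Powers: $\log z$ is the branch of the logarithm on $\mathbb C\setminus[0,+\infty)$ with $\log i=i\pi/2$ (so the argument lies in $(0,2\pi)$), and $z^a=e^{a\log z}$ for $a\in\mathbb C$. $\delta_{n,m}$ is the Kronecker delta. *)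

(* Defs.v *)
From HB Require Import structures.
From mathcomp Require Import all_boot all_order all_algebra.
From mathcomp Require Import finmap.
From mathcomp Require Import all_classical all_reals all_analysis.
From mathcomp Require Import complex.

Set Implicit Arguments.
Unset Strict Implicit.
Unset Printing Implicit Defensive.

Import Order.TTheory GRing.Theory Num.Theory.

Local Open Scope ring_scope.
Local Open Scope complex_scope.

Section Polynomials.
Variable K : fieldType.
Implicit Types (a : K) (F : {fset nat}).

(* a (a - 1) ... (a - l + 1) / l! *)
Definition gbinom a (l : nat) : K := (\prod_(i < l) (a - i%:R)) / (l`!)%:R.

Definition laguerre (n : nat) a : {poly K} :=
  \poly_(j < n.+1) ((- 1) ^+ j / (j`!)%:R * gbinom (n%:R + a) (n - j)).

(* i-th element of a finite set of natural numbers, in increasing order *)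
Definition elt (A : {fset nat}) (i : nat) : nat := nth 0%N (sort leq A) i.

Definition wrow (w n : nat) a : 'rV[{poly K}]_w :=
  \row_(j < w) (laguerre n a)^`(j).

Definition rows1 (w : nat) a (A : {fset nat}) : 'M[{poly K}]_(#|` A|, w) :=
  \matrix_(i < #|` A|, j < w) (laguerre (elt A i) a)^`(j).

Definition rows2 (w : nat) a (A : {fset nat}) : 'M[{poly K}]_(#|` A|, w) :=
  \matrix_(i < #|` A|, j < w) (laguerre (elt A i) (a + j%:R) \Po (- 'X)).

Definition Omega a F1 F2 : {poly K} :=
  let k := (#|` F1| + #|` F2|)%N in
  \det (col_mx (rows1 k a F1) (rows2 k a F2)).

(* No truncation takes place in the subtractions when the elements of F1 and
   F2 are positive: then the sum over Fi is at least 'C(#|` Fi|.+1, 2). *)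
Definition uF F1 F2 : nat :=
  (\sum_(f <- F1) f + \sum_(f <- F2) f
   - 'C(#|` F1|.+1, 2) - 'C(#|` F2|, 2))%N.

(* The index is N = n + uF F1 F2 with n \notin F1; other values of N are not
   used. *)
Definition exceptional_laguerre a F1 F2 (N : nat) : {poly K} :=
  let n := (N - uF F1 F2)%N in
  let w := (1 + (#|` F1| + #|` F2|))%N in
  \det (col_mx (wrow w n a) (col_mx (rows1 w a F1) (rows2 w a F2))).

End Polynomials.

(* Real-valued parts, as opposed to the C-valued 'Re and 'Im of Num.Theory. *)
Local Notation Re := (@complex.Re _).
Local Notation Im := (@complex.Im _).

Section ComplexAnalysis.
Variable R : realType.
Implicit Types (z a : R[i]) (D : set R) (f : R -> R[i]).

Definition cexp z : R[i] :=
  (expR (Re z) * cos (Im z)) +i* (expR (Re z) * sin (Im z)).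

Definition cmod z : R := Num.sqrt (Re z ^+ 2 + Im z ^+ 2).

(* argument in ]0, 2 pi[ on the complement of [0, +oo[ *)
Definition carg z : R :=
  if 0 <= Im z then acos (Re z / cmod z) else 2 * pi - acos (Re z / cmod z).

Definition clog z : R[i] := ln (cmod z) +i* carg z.

Definition cpow z a : R[i] := cexp (a * clog z).

Definition cintegrable D f : Prop :=
  (lebesgue_measure : measure _ R).-integrable D (EFin \o (fun t => Re (f t)))
  /\
  (lebesgue_measure : measure _ R).-integrable D (EFin \o (fun t => Im (f t))).

Definition cintegral D f : R[i] :=
  Rintegral lebesgue_measure D (fun t => Re (f t)) +i*
  Rintegral lebesgue_measure D (fun t => Im (f t)).

Definition euler_integral z : R[i] :=
  cintegral `]0, +oo[%classic
    (fun t => cexp ((z - 1) * (ln t)%:C) * (expR (- t))%:C).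

(* Euler's integral where it converges, continued to the left by
   Gamma z = Gamma (z + N) / (z (z + 1) ... (z + N - 1)). *)
Definition cGamma z : R[i] :=
  let N := if 0 < Re z then 0%N else (Num.truncn (- Re z)).+1 in
  euler_integral (z + N%:R) / \prod_(i < N) (z + i%:R).

Definition half_line_up (r x : R) : R[i] := x +i* r.
Definition half_line_down (r x : R) : R[i] := x +i* (- r).
Definition left_arc (r t : R) : R[i] := (r * cos t) +i* (r * sin t).

Definition Lambda (r : R) : set R[i] :=
  (half_line_up r @` `[0, +oo[ `|` left_arc r @` `[pi / 2, 3 * pi / 2] `|`
   half_line_down r @` `[0, +oo[)%classic.

(* The integral of g along Lambda r converges and is equal to v.  The upper
   half line is traversed from +oo + i r to i r, whence the minus sign; the
   factor in the second integral is the derivative i r e^(i t) of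
   left_arc r. *)
Definition is_Lambda_integral (r : R) (g : R[i] -> R[i]) (v : R[i]) : Prop :=
  let up := fun x => g (half_line_up r x) in
  let arc := fun t =>
    g (left_arc r t) * ((- (r * sin t)) +i* (r * cos t)) in
  let down := fun x => g (half_line_down r x) in
  [/\ cintegrable `[0, +oo[%classic up,
      cintegrable `[pi / 2, 3 * pi / 2]%classic arc,
      cintegrable `[0, +oo[%classic down &
      - cintegral `[0, +oo[%classic up
      + cintegral `[pi / 2, 3 * pi / 2]%classic arc
      + cintegral `[0, +oo[%classic down = v].

End ComplexAnalysis.

(* Main.v *)
(* Write e^(x) L_f^alpha(-x) for the seed attached to f in F2 and L_f^alpha for
   the one attached to f in F1: Omega is the Wronskian of the seeds (up to a
   power of e^x), and L_n^{alpha;F} / Omega is, up to a sign, the result of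
   applying to L_n^alpha the iterated Darboux transformation
   v |-> v' - (h'/h) v with respect to the seeds.  Each step turns the
   operator x D^2 + (a - x) D + q into one of the same form with a + 1 in place
   of a, and it kills no eigenfunction whose eigenvalue differs from that of
   the seed.  The eigenvalues - f and f + alpha + 1 of the seeds are distinct
   because alpha is not a negative integer, whence Omega <> 0.  One integration
   by parts, whose boundary terms vanish on Lambda_r, shows that a step with
   eigenvalue l multiplies the pairing of two eigenfunctions by l - l_m,
   l_m = - m.  This reduces the theorem to the Laguerre polynomials themselves,
   where derivation and the same integration by parts reduce it to Hankel's
   formula for the integral of z^(alpha + n) e^(-z).  All this requires only
   that finitely many denominators be bounded away from 0 on |z| >= r, so r is
   taken large. *)
Require Import Defs.
From HB Require Import structures.
From mathcomp Require Import all_boot all_order all_algebra generic_quotient.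
From mathcomp Require Import finmap.
From mathcomp Require Import all_classical all_reals all_analysis.
From mathcomp Require Import measurable_realfun.
From mathcomp Require Import complex.
From mathcomp Require Import ring lra.

Set Implicit Arguments.
Unset Strict Implicit.
Unset Printing Implicit Defensive.

Import Order.TTheory GRing.Theory Num.Theory.
Import numFieldNormedType.Exports.

Local Open Scope ring_scope.
Local Open Scope complex_scope.

Local Notation Re := (@complex.Re _).
Local Notation Im := (@complex.Im _).
Local Notation left_arc := Defs.left_arc.

(** * Darboux transformations in a differential field *)

(** Since e^x is not rational, an eigenfunction e^(c x) g is carried as the pair (c, g), on which D
    acts as [conn c]; the Darboux part is then pure algebra in a differential field, later
    instantiated by a field of fractions. Integration enters this algebra only as a linear
    functional [I] that vanishes on the exact expressions of [I_exact]. On the analytic side, path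
    integrals are evaluated through explicit primitives along curves. The many values of z^a are
    handled by writing integrands and primitives as functions of w = log z, along smooth lifts of
    the three pieces of the path. In Hankel's formula the primitive is e^((b+1)w) times a
    single-valued function of e^w. Its limits at the two ends of the path differ by the factor e^(2
    pi i b), which is the origin of e^(2 pi i alpha) - 1. This primitive needs Re b > -1; the
    remaining exponents are reached because integration by parts on the path obeys the recursion by
    which [cGamma] is continued. *)

Section Darboux.
Variables (K : fieldType) (der : K -> K).
Hypothesis derD : forall x y, der (x + y) = der x + der y.
Hypothesis derM : forall x y, der (x * y) = der x * y + x * der y.
Implicit Types (c g h x a l : K) (s : seq (K * K)).

Lemma der0 : der 0 = 0.
Proof. by apply: (addrI (der 0)); rewrite -derD !addr0. Qed.

Lemma der1 : der 1 = 0.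
Proof. by apply: (addrI (der 1)); rewrite addr0 -{3}(mulr1 1) derM mulr1 mul1r. Qed.

Lemma derN x : der (- x) = - der x.
Proof. by apply/eqP; rewrite -subr_eq0 opprK -derD addNr der0. Qed.

(* conn c g stands for the derivative of e^(c x) g, divided by e^(c x). *)
Definition conn c g := der g + c * g.

Lemma connD c g h : conn c (g + h) = conn c g + conn c h.
Proof. by rewrite /conn derD; ring. Qed.

Lemma connM c g h : conn c (g * h) = der g * h + g * conn c h.
Proof. by rewrite /conn derM; ring. Qed.

Lemma conn0 c : conn c 0 = 0.
Proof. by rewrite /conn der0 mulr0 addr0. Qed.

Lemma conn0l g : conn 0 g = der g.
Proof. by rewrite /conn mul0r addr0. Qed.

Lemma conn_sum c I (r : seq I) (P : pred I) (F : I -> K) :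
  conn c (\sum_(i <- r | P i) F i) = \sum_(i <- r | P i) conn c (F i).
Proof. exact: (big_morph (conn c) (connD c) (conn0 c)). Qed.

(** The logarithmic derivative of e^(c x) h, which is again an element of [K]. *)
Definition logder c h := conn c h / h.

(** The tail of the list acts first: the head seed is itself transformed by the tail before it
    defines the last Darboux step. The factor e^(c x) is divided out throughout. *)
Fixpoint act s c g : K :=
  if s is s0 :: s' then
    conn c (act s' c g) - logder s0.1 (act s' s0.1 s0.2) * act s' c g
  else g.

(** No transformed seed vanishes, so every [logder] in [act] is a genuine quotient and not the
    default value of a division by 0. *)
Fixpoint nonsingular s : Prop :=
  if s is s0 :: s' then act s' s0.1 s0.2 != 0 /\ nonsingular s' else True.

Lemma act_seed s (s0 : K * K) : nonsingular s -> s0 \in s -> act s s0.1 s0.2 = 0.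
Proof.
elim: s => // s1 s IH /= [h0 nd]; rewrite inE => /orP[/eqP ->|/(IH nd) ->].
  by rewrite /logder mulfVK// subrr.
by rewrite conn0 mulr0 subr0.
Qed.

(** The point is that [C] depends neither on [c] nor on [g]: one column operation then acts
    correctly on all rows of a Wronskian, although their exponents differ. *)
Lemma act_monic s : exists C : nat -> K, C (size s) = 1 /\
  forall c g, act s c g = \sum_(j < (size s).+1) C j * iter j (conn c) g.
Proof.
elim: s => [|s0 s [C [C1 CE]]] /=.
  by exists (fun=> 1); split=> // c g; rewrite big_ord1 mul1r.
set rho := logder _ _.
(* Nothing is known of [C] beyond [size s]. Cutting it off there makes the new leading coefficient
   exactly the old one, namely 1. *)
pose C0 j := if (j <= size s)%N then C j else 0.
exists (fun j => der (C0 j) - rho * C0 j + (if j is j'.+1 then C j' else 0)).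
split.
  by rewrite /C0 ltnn der0 mulr0 subrr add0r C1.
move=> c g; rewrite CE conn_sum.
rewrite (eq_bigr _ (fun j _ => connM _ _ _)) big_split/=.
transitivity (\sum_(j < (size s).+1) (der (C j) - rho * C j) * iter j (conn c) g
    + \sum_(j < (size s).+1) C j * iter j.+1 (conn c) g).
  rewrite mulr_sumr addrAC; congr (_ + _).
  by rewrite -sumrB; apply: eq_bigr => j _; rewrite mulrBl mulrA.
rewrite [RHS](eq_bigr _ (fun j _ => mulrDl _ _ _)) big_split/=; congr (_ + _).
  rewrite [RHS]big_ord_recr/= /C0 ltnn der0 mulr0 subrr mul0r addr0.
  by apply: eq_bigr => j _; rewrite -ltnS ltn_ord.
by rewrite [RHS]big_ord_recl/= mul0r add0r.
Qed.

Definition wronskian n s : 'M[K]_n :=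
  \matrix_(i < n, j < n) iter j (conn (nth 0 s i).1) (nth 0 s i).2.


(** A column operation turns the last column into the values of [act s], which vanish on the seeds.
    Only the row of [y] survives, in the top right corner, whence the sign. *)
Lemma det_wronskian_cons s (y : K * K) : nonsingular s ->
  \det (wronskian (size s).+1 (y :: s)) =
  (- 1) ^+ size s * (act s y.1 y.2 * \det (wronskian (size s) s)).
Proof.
move=> nd; have [C [C1 CE]] := act_monic s; set n := size s.
set M := wronskian _ _.
(* The identity with its last column replaced by the coefficients of [act s]: unitriangular because
   the operator is monic. *)
pose U := \matrix_(i < n.+1, j < n.+1)
  (if j == ord_max then C i else (i == j)%:R : K).
have detU : \det U = 1.
  rewrite -det_tr det_trig.
    apply: big1 => i _; rewrite !mxE eqxx; case: eqP => // ->.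
    by rewrite /= C1.
  apply/is_trig_mxP => i j ij; rewrite !mxE.
  have -> : (i == ord_max) = false.
    by apply/negP => /eqP im; move: ij; rewrite im ltnNge -ltnS ltn_ord.
  by rewrite -(inj_eq val_inj)/= gtn_eqF.
have MU i j : (M *m U) i j = if j == ord_max then
    act s (nth 0 (y :: s) i).1 (nth 0 (y :: s) i).2 else M i j.
  rewrite mxE; case: ifP => [jm|jm].
    by rewrite CE; apply: eq_bigr => l _; rewrite !mxE jm mulrC.
  rewrite (bigD1 j)//= !mxE jm eqxx mulr1 big1 ?addr0// => l lj.
  by rewrite !mxE jm (negPf lj) mulr0.
rewrite -[LHS]mulr1 -{1}detU -det_mulmx (expand_det_col _ ord_max).
rewrite big_ord_recl MU eqxx /= big1 ?addr0; last first.
  by move=> i _; rewrite MU eqxx lift0 /= act_seed ?mul0r ?mem_nth ?ltn_ord.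
rewrite /cofactor /= add0n mulrCA; congr (_ * (_ * \det _)).
apply/matrixP => i j; rewrite [LHS]mxE [LHS]mxE MU.
have -> : (lift ord_max j == ord_max) = false by rewrite eq_sym (negPf (neq_lift _ _)).
by rewrite !mxE lift0 lift_max.
Qed.

Lemma nonsingular_cons_det s (y : K * K) : nonsingular (y :: s) ->
  \det (wronskian (size s) s) != 0 ->
  \det (wronskian (size (y :: s)) (y :: s)) != 0.
Proof.
move=> /= [h0 nd] d0; rewrite det_wronskian_cons// !mulf_neq0//.
by rewrite expf_neq0// oppr_eq0 oner_neq0.
Qed.

Lemma det_wronskian_neq0 s : nonsingular s ->
  \det (wronskian (size s) s) != 0.
Proof.
elim: s => [|y s IH] nd; first by rewrite det_mx00 oner_neq0.
by apply: nonsingular_cons_det => //; apply: IH; case: nd.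
Qed.

Variables (x : K).
Hypothesis derx : der x = 1.

Definition lop a c g := x * conn c (conn c g) + (a - x) * conn c g.

Definition base a h c0 := a - x + x * logder c0 h.

(** The seed equation is a Riccati equation for rho = h'/h, and that is exactly the condition for
    the second order operator minus l0 to factor as (x D + b)(D - rho), with b = [base a h c0]. *)
Lemma darboux_factor a q c0 h l0 c v l : h != 0 ->
  lop a c0 h + q * h = l0 * h -> lop a c v + q * v = l * v ->
  let v1 := conn c v - logder c0 h * v in
  x * conn c v1 + base a h c0 * v1 = (l - l0) * v.
Proof.
move=> h0 Eh Ev v1; rewrite /base /v1 /lop in Eh Ev *.
set rho := logder c0 h.
have rhoh : conn c0 h = rho * h by rewrite /rho /logder mulfVK.
have Eric : x * (der rho + rho ^+ 2) + (a - x) * rho + q = l0.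
  apply: (mulIf h0); rewrite -Eh rhoh connM rhoh; ring.
have -> : conn c (conn c v - rho * v) =
    conn c (conn c v) - der rho * v - rho * conn c v.
  by rewrite {1}/conn derD derN derM /conn; ring.
rewrite -Eric mulrBl -Ev; ring.
Qed.

(** Applying D - rho to the factorization exchanges its two factors, and l - l0 passes through
    because it is a constant. The commutation D x = x D + 1 is what raises [a] to [a + 1]. *)
Lemma darboux_eigen a q c0 h l0 c v l : h != 0 -> der (l - l0) = 0 ->
  lop a c0 h + q * h = l0 * h -> lop a c v + q * v = l * v ->
  let v1 := conn c v - logder c0 h * v in
  lop (a + 1) c v1 +
    (l0 + der (base a h c0) - logder c0 h * base a h c0) * v1 = l * v1.
Proof.
move=> h0 dl Eh Ev v1; have := darboux_factor h0 Eh Ev; rewrite -/v1.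
set b := base a h c0; set rho := logder c0 h => F.
have : conn c (x * conn c v1 + b * v1) - rho * (x * conn c v1 + b * v1) =
   (l - l0) * v1.
  by rewrite F connM dl /v1 -/rho; ring.
rewrite connD !connM derx /lop.
have -> : a = b + x - x * rho by rewrite /b /base -/rho; ring.
move=> E.
have -> : l * v1 = (l - l0) * v1 + l0 * v1 by ring.
rewrite -E; ring.
Qed.

(* A seed ((c, g), l) is the eigenfunction e^(c x) g with eigenvalue l. *)
Lemma act_eigen a (s : seq (K * K * K)) :
  (forall t, t \in s -> [/\ t.1.2 != 0, der t.2 = 0 &
                            lop a t.1.1 t.1.2 = t.2 * t.1.2]) ->
  uniq (map snd s) ->
  nonsingular (map fst s) /\
  exists q, forall c g l, der l = 0 -> lop a c g = l * g ->
   (lop (a + (size s)%:R) c (act (map fst s) c g) + q * act (map fst s) c g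
     = l * act (map fst s) c g) /\
   (g != 0 -> l \notin map snd s -> act (map fst s) c g != 0).
Proof.
elim: s => [|s0 s IH] es us /=.
  by split=> //; exists 0 => c g l dl E; rewrite addr0 mul0r addr0.
have es' t : t \in s -> [/\ t.1.2 != 0, der t.2 = 0 &
                            lop a t.1.1 t.1.2 = t.2 * t.1.2].
  by move=> ts; apply: es; rewrite inE ts orbT.
have [g0 dl0 E0] := es s0 (mem_head _ _).
case/andP: us => s0s us.
have [nd [q H]] := IH es' us.
have [Eh] := H _ _ _ dl0 E0; move/(_ g0 s0s) => h0.
split=> //.
exists (s0.2 + der (base (a + (size s)%:R) (act (map fst s) s0.1.1 s0.1.2) s0.1.1)
   - logder s0.1.1 (act (map fst s) s0.1.1 s0.1.2) *
     base (a + (size s)%:R) (act (map fst s) s0.1.1 s0.1.2) s0.1.1).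
move=> c g l dl Eg; have [Ev v0] := H _ _ _ dl Eg; split.
  rewrite -addn1 natrD addrA; apply: darboux_eigen Ev => //.
  by rewrite derD derN dl dl0 subr0.
move=> gn0; rewrite inE negb_or => /andP[ll0 ls].
apply: contra_neq (v0 gn0 ls) => v10.
(* If the transform vanished, the factorization would read 0 = (l - l0) v. *)
have /= := darboux_factor h0 Eh Ev; rewrite v10 conn0 !mulr0 addr0 => /esym/eqP.
by rewrite mulf_eq0 subr_eq0 (negPf ll0)/= => /eqP.
Qed.


Section Functional.
Variables (C : fieldType) (iota : {rmorphism C -> K}) (alpha : C).
Hypothesis der_iota : forall z, der (iota z) = 0.
Variable reg : K -> Prop.
Hypothesis regD : forall g h, reg g -> reg h -> reg (g + h).
Hypothesis regM : forall g h, reg g -> reg h -> reg (g * h).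
Hypothesis reg_iota : forall z, reg (iota z).
Hypothesis reg_der : forall g, reg g -> reg (der g).
Hypothesis regx : reg x.
Variable I : K -> C.
Hypothesis ID : forall g h, reg g -> reg h -> I (g + h) = I g + I h.
Hypothesis IZ : forall z g, reg g -> I (iota z * g) = z * I g.
(** [I] models integration against x^alpha e^(-x). The argument times this weight is the derivative
    of x^(alpha+1) e^(-x) h, so this is integration by parts without boundary terms. *)
Hypothesis I_exact : forall h, reg h ->
  I (x * der h + (iota (alpha + 1) - x) * h) = 0.

Lemma regN g : reg g -> reg (- g).
Proof. by rewrite -mulN1r -(rmorphN1 iota) => rg; apply: regM. Qed.

Lemma regB g h : reg g -> reg h -> reg (g - h).
Proof. by move=> rg rh; apply: regD => //; apply: regN. Qed.

Lemma regX n : reg (x ^+ n).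
Proof.
elim: n => [|n IH]; first by rewrite expr0 -(rmorph1 iota).
by rewrite exprS; apply: regM.
Qed.

Lemma reg_conn c g : reg c -> reg g -> reg (conn c g).
Proof. by move=> rc rg; apply: regD; [exact: reg_der|exact: regM]. Qed.

(** Only the logarithmic derivatives occur as coefficients of the Darboux steps, so only they have
    to be regular. *)
Fixpoint regular_seeds s : Prop :=
  if s is s0 :: s' then
    reg (logder s0.1 (act s' s0.1 s0.2)) /\ regular_seeds s' else True.

Lemma reg_act s c g : reg c -> regular_seeds s -> reg g -> reg (act s c g).
Proof.
move=> rc; elim: s => //= s0 s IH [r0 rs] rg.
by apply: regB; [apply: reg_conn|apply: regM]; auto.
Qed.

(** The power of [x] follows the parameter: after k steps the operator has parameter alpha + 1 + k,
    and its natural weight is x^(alpha+k) e^(-x). *)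
Lemma I_darboux (s : seq (K * K * C)) u v lu lv : 
  (forall t, t \in s -> t.1.2 != 0 /\
     lop (iota (alpha + 1)) t.1.1 t.1.2 = iota t.2 * t.1.2) ->
  uniq (map snd s) -> regular_seeds (map fst s) -> reg u -> reg v ->
  lop (iota (alpha + 1)) 0 u = iota lu * u ->
  lop (iota (alpha + 1)) 0 v = iota lv * v ->
  I (x ^+ size s * (act (map fst s) 0 u * act (map fst s) 0 v)) =
  \prod_(t <- s) (t.2 - lv) * I (u * v).
Proof.
move=> + + + ru rv Eu Ev; have r0 : reg 0 by rewrite -(rmorph0 iota).
elim: s => [|s0 s IH] es us rs.
  by rewrite expr0 mul1r big_nil mul1r.
have es' t : t \in s -> t.1.2 != 0 /\
     lop (iota (alpha + 1)) t.1.1 t.1.2 = iota t.2 * t.1.2.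
  by move=> ts; apply: es; rewrite inE ts orbT.
case: (es s0 (mem_head _ _)) => g0 E0.
move: us rs => /= /andP[s0s us] [rs0 rs].
pose s' := [seq (t.1, iota t.2) | t <- s].
have fs' : map fst s' = map fst s by rewrite -map_comp.
have ss' : map snd s' = map iota (map snd s) by rewrite -!map_comp.
have zs' : size s' = size s by rewrite size_map.
have es'' t : t \in s' -> [/\ t.1.2 != 0, der t.2 = 0 &
    lop (iota (alpha + 1)) t.1.1 t.1.2 = t.2 * t.1.2].
  by case/mapP => t' /es'[? ?] ->; split=> /=; rewrite ?der_iota.
have us' : uniq (map snd s') by rewrite ss' map_inj_uniq//; exact: fmorph_inj.
have [_ [q]] := act_eigen es'' us'; rewrite fs' ss' zs' => H.
have [Eh h0] := H _ _ _ (der_iota _) E0.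
have {}h0 : act (map fst s) s0.1.1 s0.1.2 != 0.
  by apply: h0 => //; rewrite mem_map//; exact: fmorph_inj.
have [Ev' _] := H _ _ _ (der_iota _) Ev.
have /= F := darboux_factor h0 Eh Ev'.
rewrite big_cons -mulrA -IH//.
set rho := logder _ _ in F rs0 *; set k := size s in F *.
set U := act _ 0 u; set V := act _ 0 v in F *.
set V1 := conn 0 V - rho * V in F *.
have rU : reg U by apply: reg_act.
have rV : reg V by apply: reg_act.
have rV1 : reg V1 by apply: regB; [apply: reg_conn|apply: regM].
have rH : reg (x ^+ k * (U * V1)) by apply: regM => //; [exact: regX|exact: regM].
have := I_exact rH.
(* The derivative of [U] yields the first transformed factor; the rest is x^k U (x V1' + b V1),
   which [darboux_factor] turns into a multiple of x^k U V. *)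
have -> : x * der (x ^+ k * (U * V1)) + (iota (alpha + 1) - x) * (x ^+ k * (U * V1)) =
   x ^+ k.+1 * ((conn 0 U - rho * U) * V1)
   + iota (lv - s0.2) * (x ^+ k * (U * V)).
  rewrite rmorphB -[RHS]/(_ + _ * (_ * (U * V))).
  have -> : (iota lv - iota s0.2) * (x ^+ k * (U * V)) =
    x ^+ k * U * ((iota lv - iota s0.2) * V) by ring.
  rewrite -F /base -/rho !derM.
  have -> : x * (der (x ^+ k) * (U * V1) + x ^+ k * (der U * V1 + U * der V1)) =
     x * der (x ^+ k) * (U * V1) + x ^+ k.+1 * (der U * V1 + U * der V1).
    by rewrite exprS; ring.
  have -> : x * der (x ^+ k) = k%:R * x ^+ k.
    elim: {F rH} k => [|k IHk]; first by rewrite expr0 der1 mulr0 mul0r.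
    by rewrite exprS derM derx mul1r mulrDr mulrCA IHk mulrCA -exprS -natr1 mulrDl mul1r addrC.
  rewrite /conn exprS; ring.
have rUV : reg (x ^+ k * (U * V)).
  by apply: regM; [exact: regX|exact: regM].
have rU1V1 : reg (x ^+ k.+1 * ((conn 0 U - rho * U) * V1)).
  apply: regM; first exact: regX.
  by apply: regM => //; apply: regB; [exact: reg_conn|exact: regM].
rewrite ID ?IZ//; last exact: regM.
by move=> /eqP; rewrite addr_eq0 => /eqP ->; ring.
Qed.

(** [L n j] plays the Laguerre polynomial of degree n and parameter alpha + j. Each integration by
    parts trades an eigenvalue m for a derivative on both factors, lowering both degrees and raising
    j, until one factor is the constant 1. *)
Lemma I_laguerre (L : nat -> nat -> K) :
  [pchar C] =i pred0 ->
  (forall n j, reg (L n j)) -> (forall j, L 0%N j = 1) ->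
  (forall n j, der (L n.+1 j) = - L n j.+1) ->
  (forall n j, lop (iota (alpha + 1) + j%:R) 0 (L n j) = - n%:R * L n j) ->
  forall n m j, I (x ^+ j * (L n j * L m j)) =
    (n == m)%:R * I (x ^+ (j + n)) / (n`!)%:R.
Proof.
move=> ch rL L0 dL EL.
have step n m j : m%:R * I (x ^+ j * (L n j * L m j)) =
    I (x ^+ j.+1 * (der (L n j) * der (L m j))).
  have r1 : reg (x ^+ j * (L n j * der (L m j))).
    by apply: regM; [exact: regX|apply: regM => //; apply: reg_der].
  have := I_exact r1.
  have -> : x * der (x ^+ j * (L n j * der (L m j))) +
      (iota (alpha + 1) - x) * (x ^+ j * (L n j * der (L m j))) =
     x ^+ j.+1 * (der (L n j) * der (L m j)) +
     iota (- m%:R) * (x ^+ j * (L n j * L m j)).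
    have -> : iota (- m%:R) * (x ^+ j * (L n j * L m j)) =
        x ^+ j * L n j * (- m%:R * L m j) by rewrite rmorphN rmorph_nat; ring.
    rewrite -EL !derM.
    have -> : x * (der (x ^+ j) * (L n j * der (L m j)) +
          x ^+ j * (der (L n j) * der (L m j) + L n j * der (der (L m j)))) =
       x * der (x ^+ j) * (L n j * der (L m j)) +
       x ^+ j.+1 * (der (L n j) * der (L m j) + L n j * der (der (L m j))).
      by rewrite exprS; ring.
    have -> : x * der (x ^+ j) = j%:R * x ^+ j.
      elim: {r1} j => [|k IHk]; first by rewrite expr0 der1 mulr0 mul0r.
      by rewrite exprS derM derx mul1r mulrDr mulrCA IHk mulrCA -exprS -natr1 mulrDl mul1r addrC.
    by rewrite /lop !conn0l exprS; ring.
  have rLL : reg (x ^+ j * (L n j * L m j)).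
    by apply: regM; [exact: regX|exact: regM].
  have rdd : reg (x ^+ j.+1 * (der (L n j) * der (L m j))).
    by apply: regM; [exact: regX|apply: regM; exact: reg_der].
  rewrite ID ?IZ//; last exact: regM.
  by move=> /eqP; rewrite addr_eq0 => /eqP ->; ring.
have nz k : k.+1%:R != 0 :> C by rewrite ((pcharf0P C).1 ch).
elim=> [|n IH] [|m] j.
- by rewrite !L0 !mulr1 addn0 mul1r divr1.
- apply: (mulfI (nz m)); rewrite step L0 der1 mul0r mulr0 !mul0r mulr0.
  by rewrite -(rmorph0 iota) -[iota 0]mulr1 IZ ?mul0r// -(rmorph1 iota).
(* The eigenvalue of the second factor is 0 here and cannot be divided out; exchanging the factors
   uses the nonzero one. *)
- apply: (mulfI (nz n)); rewrite [L n.+1 j * _]mulrC step.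
  rewrite L0 der1 mul0r mulr0 !mul0r mulr0.
  by rewrite -(rmorph0 iota) -[iota 0]mulr1 IZ ?mul0r// -(rmorph1 iota).
apply: (mulfI (nz m)); rewrite step !dL mulrNN IH eqSS addSnnS.
case: eqP => [->|_]; last by rewrite !mul0r mulr0.
by rewrite factS natrM !mul1r invfM mulrCA [X in _ = _ * X]mulrA divff ?mul1r.
Qed.

End Functional.

End Darboux.

(** * Laguerre polynomials and seed functions *)

Section Laguerre.
Variable K : numFieldType.
Implicit Types a : K.

Lemma natS_neq0 n : n.+1%:R != 0 :> K. Proof. by rewrite pnatr_eq0. Qed.

Lemma fact_neq0 n : (n`!)%:R != 0 :> K.
Proof. by rewrite pnatr_eq0 -lt0n fact_gt0. Qed.

Lemma gbinom0 a : gbinom a 0 = 1.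
Proof. by rewrite /gbinom big_ord0 fact0 divr1. Qed.

Lemma gbinomS a l : gbinom a l.+1 * l.+1%:R = gbinom a l * (a - l%:R).
Proof.
rewrite /gbinom big_ord_recr/= factS natrM.
field.
by rewrite ?nat1r ?natS_neq0 ?fact_neq0.
Qed.

Lemma gbinom_pascal a l : gbinom (a + 1) l.+1 = gbinom a l.+1 + gbinom a l.
Proof.
rewrite /gbinom [in LHS]big_ord_recl [in RHS]big_ord_recr/= factS natrM.
have -> : \prod_(i < l) (a + 1 - (bump 0 i)%:R) = \prod_(i < l) (a - i%:R).
  by apply: eq_bigr => i _; rewrite /bump/= natrD; ring.
field.
by rewrite ?nat1r ?natS_neq0 ?fact_neq0.
Qed.

Lemma coef_laguerre n a j : (laguerre n a)`_j =
  if (j <= n)%N then (- 1) ^+ j / (j`!)%:R * gbinom (n%:R + a) (n - j) else 0.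
Proof. by rewrite coef_poly ltnS. Qed.

Lemma laguerre0 a : laguerre 0 a = 1.
Proof.
apply/polyP => j; rewrite coef_laguerre coef1 leqn0.
by case: eqP => // ->; rewrite gbinom0 expr0 fact0 divr1 mulr1.
Qed.

Lemma laguerre_neq0 n a : laguerre n a != 0.
Proof.
apply/eqP => /(congr1 (coefp n)); rewrite /= coef_laguerre leqnn subnn gbinom0 mulr1 coef0.
by apply/eqP; rewrite mulf_neq0 ?invr_neq0 ?fact_neq0// expf_neq0// oppr_eq0 oner_neq0.
Qed.

Lemma deriv_laguerre n a : (laguerre n.+1 a)^`() = - laguerre n (a + 1).
Proof.
apply/polyP => j; rewrite coef_deriv coefN !coef_laguerre ltnS.
case: leqP => jn; last by rewrite mul0rn oppr0.
rewrite subSS -mulr_natr factS natrM exprS -[n.+1%:R]natr1 -addrA [1 + a]addrC.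
field.
by rewrite ?nat1r ?natS_neq0 ?fact_neq0.
Qed.

(** Pascal's rule, coefficient by coefficient, after [deriv_laguerre] has turned the derivative into
    a polynomial of lower degree and higher parameter. *)
Lemma laguerreD1 n a : laguerre n (a + 1) = laguerre n a - (laguerre n a)^`().
Proof.
case: n => [|n]; first by rewrite !laguerre0 derivC subr0.
rewrite deriv_laguerre opprK; apply/polyP => j.
rewrite coefD !coef_laguerre.
case: ltngtP => [jn|jn|->].
- have jn' : (j <= n)%N by rewrite -ltnS.
  by rewrite jn' (subSn jn') addrA gbinom_pascal -[n.+1%:R]natr1 -addrA [1 + a]addrC; ring.
- by rewrite leqNgt (ltn_trans _ jn)// addr0.
- by rewrite ltnn subnn !gbinom0 addr0.
Qed.

Lemma laguerre_ode n a :
  'X * (laguerre n a)^`()^`() + ((a + 1)%:P - 'X) * (laguerre n a)^`() =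
  (- n%:R)%:P * laguerre n a.
Proof.
apply/polyP => j; rewrite polyCN mulNr coefN coefCM coefD mulrBl coefB coefCM !coefXM.
set c := fun j => (laguerre n a)`_j.
(* The differential equation is equivalent to this two-term recursion for the coefficients. *)
have cS : c j.+1 * j.+1%:R * (j.+1%:R + a) = (j%:R - n%:R) * c j.
  rewrite /c !coef_laguerre; case: (ltngtP j n) => [jn|jn|->].
  - rewrite -(subnSK jn).
    have E := gbinomS (n%:R + a) (n - j.+1).
    have E1 : gbinom (n%:R + a) (n - j.+1).+1 * (j%:R - n%:R) =
       - (gbinom (n%:R + a) (n - j.+1) * (j.+1%:R + a)).
      move: E; rewrite (natrB _ jn) (subnSK jn) (natrB _ (ltnW jn)).
      have -> : n%:R + a - (n%:R - j.+1%:R) = j.+1%:R + a by ring.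
      by move=> <-; rewrite -mulrN opprB.
    rewrite [RHS]mulrC -[RHS]mulrA E1 factS natrM exprS.
    field.
    by rewrite ?nat1r ?natS_neq0 ?fact_neq0.
  - by rewrite mulr0 !mul0r.
  - by rewrite subrr !mul0r.
have -> : (if j == 0 then 0 else (laguerre n a)^`()^`()`_j.-1) = c j.+1 * j.+1%:R * j%:R.
  case: j {cS} => [|j]; first by rewrite mulr0.
  by rewrite /= !coef_deriv !mulr_natr.
have -> : (if j == 0 then 0 else (laguerre n a)^`()`_j.-1) = c j * j%:R.
  case: j {cS} => [|j]; first by rewrite mulr0.
  by rewrite /= !coef_deriv !mulr_natr.
rewrite coef_deriv -[(laguerre n a)`_j.+1 *+ _]mulr_natr -/(c j) -/(c j.+1).
have -> : c j.+1 * j.+1%:R * j%:R + ((a + 1) * (c j.+1 * j.+1%:R) - c j * j%:R) =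
  c j.+1 * j.+1%:R * (j.+1%:R + a) - c j * j%:R by rewrite -[j.+1%:R]natr1; ring.
by rewrite cS; ring.
Qed.

End Laguerre.

(** * The derivation of rational functions, and the Laguerre seeds *)

Section FractionDerivation.
Variables (C : numFieldType) (K : fieldType) (tf : {rmorphism {poly C} -> K}).
Variables num den : K -> {poly C}.
Hypothesis tf_eq0 : forall p, (tf p == 0) = (p == 0).
Hypothesis den_neq0 : forall q, den q != 0.
Hypothesis num_den : forall q, q = tf (num q) / tf (den q).
Implicit Types (p s : {poly C}) (q : K).

Lemma tf_eq p s : (tf p == tf s) = (p == s).
Proof. by rewrite -subr_eq0 -rmorphB tf_eq0 subr_eq0. Qed.

Definition fder q : K :=
  tf ((num q)^`() * den q - num q * (den q)^`()) / tf (den q ^+ 2).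

Lemma divff_eq p s p1 s1 : s != 0 -> s1 != 0 ->
  (tf p / tf s = tf p1 / tf s1) <-> (p * s1 = p1 * s).
Proof.
move=> s0 s10; have ts0 : tf s != 0 by rewrite tf_eq0.
have ts10 : tf s1 != 0 by rewrite tf_eq0.
split=> /eqP E; apply/eqP; move: E; rewrite eqr_div// -!rmorphM;
  by rewrite tf_eq.
Qed.

(** [fder] is defined through one chosen fraction; the quotient rule gives the same value for all of
    them. *)
Lemma fder_div p s : s != 0 ->
  fder (tf p / tf s) = tf (p^`() * s - p * s^`()) / tf (s ^+ 2).
Proof.
move=> s0; rewrite /fder; set q := tf p / tf s.
have := num_den q; set n := (num q); set d := (den q).
have d0 : d != 0 := den_neq0 _.
rewrite {1}/q => /(divff_eq _ _ s0 d0) E.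
apply/divff_eq; rewrite ?expf_neq0//.
have dE : p^`() * d + p * d^`() = n^`() * s + n * s^`() by rewrite -!derivM E.
apply/eqP; rewrite -subr_eq0; apply/eqP.
(* The difference of the cross products is a combination of p d = n s and of the derivative of this
   equation. *)
have -> : (n^`() * d - n * d^`()) * s ^+ 2 - (p^`() * s - p * s^`()) * d ^+ 2 =
  s * d * ((n^`() * s + n * s^`()) - (p^`() * d + p * d^`()))
  + (p * d - n * s) * (s * d^`() + s^`() * d) by ring.
by rewrite dE E !subrr mulr0 mul0r addr0.
Qed.

Lemma fder_tf p : fder (tf p) = tf p^`().
Proof.
have := fder_div p (oner_neq0 {poly C}).
by rewrite rmorph1 divr1 expr1n rmorph1 divr1 derivC mulr0 mulr1 subr0.
Qed.

Lemma fderD q1 q2 : fder (q1 + q2) = fder q1 + fder q2.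
Proof.
rewrite (num_den q1) (num_den q2).
set n := num q1; set d := (den q1).
set n' := (num q2); set d' := (den q2).
have d0 : d != 0 := den_neq0 _; have d0' : d' != 0 := den_neq0 _.
have td0 : tf d != 0 by rewrite tf_eq0.
have td0' : tf d' != 0 by rewrite tf_eq0.
rewrite addf_div// -!rmorphM -rmorphD !fder_div ?mulf_neq0//.
rewrite addf_div ?tf_eq0 ?expf_neq0// -!rmorphM -rmorphD.
apply/divff_eq; rewrite ?mulf_neq0 ?expf_neq0//.
by rewrite !derivD !derivM; ring.
Qed.

Lemma fderM q1 q2 : fder (q1 * q2) = fder q1 * q2 + q1 * fder q2.
Proof.
rewrite (num_den q1) (num_den q2).
set n := num q1; set d := (den q1).
set n' := (num q2); set d' := (den q2).
have d0 : d != 0 := den_neq0 _; have d0' : d' != 0 := den_neq0 _.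
rewrite mulf_div -!rmorphM !fder_div ?mulf_neq0// !mulf_div -!rmorphM.
rewrite addf_div ?tf_eq0 ?mulf_neq0 ?expf_neq0// -!rmorphM -rmorphD.
apply/divff_eq; rewrite ?mulf_neq0 ?expf_neq0//.
by rewrite !derivM; ring.
Qed.

Definition iota_frac : {rmorphism C -> K} := (tf \o polyC)%FUN.

Lemma iota_fracE z : iota_frac z = tf z%:P. Proof. by []. Qed.

Lemma fder_iota z : fder (iota_frac z) = 0.
Proof. by rewrite iota_fracE fder_tf derivC rmorph0. Qed.

Lemma fder_X : fder (tf 'X) = 1.
Proof. by rewrite fder_tf derivX rmorph1. Qed.

Definition lag_neg f a := tf (laguerre f a \Po (- 'X)).

Lemma lop_laguerre n a :
  lop fder (tf 'X) (iota_frac (a + 1)) 0 (tf (laguerre n a)) =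
  iota_frac (- n%:R) * tf (laguerre n a).
Proof.
rewrite /lop !conn0l !fder_tf !iota_fracE -rmorphB -!rmorphM -rmorphD.
by rewrite laguerre_ode.
Qed.

(** Differentiating e^x L_f^a(-x) raises the parameter by one. This is why the rows attached to F2
    contain shifted parameters where those of F1 contain derivatives. *)
Lemma conn_lag_neg f a : conn fder 1 (lag_neg f a) = lag_neg f (a + 1).
Proof.
rewrite /conn mul1r /lag_neg fder_tf -rmorphD laguerreD1 comp_polyB deriv_comp.
by rewrite derivN derivX mulrN1 addrC.
Qed.

(** Derivatives become parameter shifts, and what remains is the Laguerre equation at -x. The sign
    change and the factor e^x turn the eigenvalue -f into f + a + 1. *)
Lemma lop_lag_neg f a :
  lop fder (tf 'X) (iota_frac (a + 1)) 1 (lag_neg f a) =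
  iota_frac (f%:R + a + 1) * lag_neg f a.
Proof.
rewrite /lop !conn_lag_neg /lag_neg !iota_fracE -rmorphB -!rmorphM -rmorphD.
congr (tf _); rewrite !laguerreD1 derivB.
set L := laguerre f a; have := laguerre_ode f a; rewrite -/L.
move=> /(congr1 (fun p => p \Po (- 'X))).
rewrite !(comp_polyB, comp_polyD, comp_polyM, comp_polyC, comp_polyX).
set L0 := L \Po _; set L1 := L^`() \Po _; set L2 := L^`()^`() \Po _ => E.
have -> : (f%:R + a + 1)%:P * L0 = (a + 1)%:P * L0 - (- f%:R)%:P * L0.
  by rewrite !polyCD polyCN; ring.
by rewrite -E; ring.
Qed.

Lemma iter_conn_tf j p : iter j (conn fder 0) (tf p) = tf p^`(j).
Proof. by elim: j => //= j ->; rewrite conn0l fder_tf -derivnS. Qed.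

Lemma iter_conn_lag_neg j f a :
  iter j (conn fder 1) (lag_neg f a) = lag_neg f (a + j%:R).
Proof.
elim: j => [|j IH] /=; first by rewrite addr0.
by rewrite IH conn_lag_neg -addrA natr1.
Qed.

Definition seed1 a f : K * K * C := ((0, tf (laguerre f a)), - f%:R).
Definition seed2 a f : K * K * C := ((1, lag_neg f a), f%:R + a + 1).

Definition seeds a (F1 F2 : {fset nat}) : seq (K * K * C) :=
  map (seed1 a) (sort leq F1) ++ map (seed2 a) (sort leq F2).

Lemma size_seeds a F1 F2 : size (seeds a F1 F2) = (#|` F1| + #|` F2|)%N.
Proof. by rewrite size_cat !size_map !size_sort. Qed.

Lemma mem_seeds a F1 F2 t : t \in seeds a F1 F2 ->
  t.1.2 != 0 /\
  lop fder (tf 'X) (iota_frac (a + 1)) t.1.1 t.1.2 = iota_frac t.2 * t.1.2.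
Proof.
rewrite mem_cat => /orP[] /mapP[f _ ->] /=.
  by rewrite lop_laguerre tf_eq0 laguerre_neq0.
rewrite lop_lag_neg; split=> //; rewrite tf_eq0.
by rewrite comp_poly2_eq0 ?laguerre_neq0// size_polyN size_polyX.
Qed.

Lemma uniq_seeds a F1 F2 : (forall j, a != - (j.+1)%:R) ->
  uniq (map snd (seeds a F1 F2)).
Proof.
move=> ha; rewrite map_cat -!map_comp cat_uniq; apply/and3P; split.
- rewrite map_inj_in_uniq ?sort_uniq ?fset_uniq// => f g _ _ /=.
  by move/oppr_inj/eqP; rewrite eqr_nat => /eqP.
- apply/hasPn => z /mapP[g _ ->] /=; apply/negP => /mapP[f _] /= E.
  (* Equal eigenvalues of a seed of F1 and a seed of F2 would force a = -(f + g + 1). *)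
  have /negP := ha (f + g)%N; apply; apply/eqP.
  by rewrite -addnS -addn1 !natrD opprD -E; ring.
- rewrite map_inj_in_uniq ?sort_uniq ?fset_uniq// => f g _ _ /=.
  by move/addIr/addIr/eqP; rewrite eqr_nat => /eqP.
Qed.

Lemma seeds_row a F1 F2 (i : 'I_(#|` F1| + #|` F2|)) w (j : 'I_w) :
  iter j (conn fder (nth 0 (map fst (seeds a F1 F2)) i).1)
         (nth 0 (map fst (seeds a F1 F2)) i).2 =
  tf ((col_mx (rows1 w a F1) (rows2 w a F2)) i j).
Proof.
rewrite (nth_map 0) ?size_seeds// nth_cat size_map size_sort.
rewrite -(splitK i); case: (fintype.split i) => i' /=.
  by rewrite ltn_ord !(nth_map 0%N) ?size_sort//= col_mxEu mxE iter_conn_tf.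
rewrite ltnNge leq_addr/= addKn !(nth_map 0%N) ?size_sort//= col_mxEd mxE.
by rewrite iter_conn_lag_neg.
Qed.

Lemma Omega_wronskian a F1 F2 : tf (Omega a F1 F2) =
  \det (wronskian fder (size (seeds a F1 F2)) (map fst (seeds a F1 F2))).
Proof.
rewrite size_seeds /Omega -det_map_mx; congr (\det _).
by apply/matrixP => i j; rewrite mxE [RHS]mxE seeds_row.
Qed.

Lemma exceptional_laguerre_wronskian a F1 F2 n :
  tf (exceptional_laguerre a F1 F2 (n + uF F1 F2)) =
  \det (wronskian fder (size (seeds a F1 F2)).+1
          ((0, tf (laguerre n a)) :: map fst (seeds a F1 F2))).
Proof.
rewrite size_seeds /exceptional_laguerre addnK -det_map_mx; congr (\det _).
apply/matrixP => i j; rewrite mxE [RHS]mxE.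
rewrite -(splitK i); case: (fintype.split i) => i' /=.
  by rewrite ord1 col_mxEu /= iter_conn_tf mxE.
by rewrite col_mxEd -seeds_row.
Qed.

Lemma nonsingular_seeds a F1 F2 : (forall j, a != - (j.+1)%:R) ->
  nonsingular fder (map fst (seeds a F1 F2)).
Proof.
move=> ha; pose s := [seq (t.1, iota_frac t.2) | t <- seeds a F1 F2].
have -> : map fst (seeds a F1 F2) = map fst s by rewrite /s -map_comp.
have [] := act_eigen fderD fderM fder_X (a := iota_frac (a + 1)) (s := s) => //.
  move=> _ /mapP[t /mem_seeds[t0 Et] ->]; split=> //=; exact: fder_iota.
have -> : map snd s = map iota_frac (map snd (seeds a F1 F2)).
  by rewrite /s -!map_comp.
by rewrite map_inj_uniq ?uniq_seeds//; exact: fmorph_inj.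
Qed.

Lemma Omega_neq0 (a : C) F1 F2 : (forall j, a != - (j.+1)%:R) -> Omega a F1 F2 != 0.
Proof.
move=> ha; rewrite -tf_eq0 Omega_wronskian -(size_map fst).
apply: det_wronskian_neq0; [exact: fderD|exact: fderM|].
exact: nonsingular_seeds.
Qed.

Lemma exceptional_laguerre_act a F1 F2 n : (forall j, a != - (j.+1)%:R) ->
  tf (exceptional_laguerre a F1 F2 (n + uF F1 F2)) =
  (- 1) ^+ (#|` F1| + #|` F2|) *
  (act fder (map fst (seeds a F1 F2)) 0 (tf (laguerre n a)) * tf (Omega a F1 F2)).
Proof.
move=> ha; rewrite exceptional_laguerre_wronskian Omega_wronskian.
rewrite -(size_seeds a) -(size_map fst) det_wronskian_cons//.
- exact: fderD.
- exact: fderM.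
exact: nonsingular_seeds.
Qed.

End FractionDerivation.

(** Provides the numerators and denominators that the sections over an abstract [K] assume. *)
Lemma frac_numden (T : idomainType) (q : {fraction T}) :
  q = FracField.tofrac (frac (repr q)).1 / FracField.tofrac (frac (repr q)).2.
Proof.
have d0 : FracField.tofrac (frac (repr q)).2 != 0 by rewrite tofrac_eq0 denom_ratioP.
apply: (mulIf d0); rewrite mulfVK// -{1}(reprK q); unlock FracField.tofrac.
rewrite !piE; apply/eqP; rewrite piE FracField.equivfE.
rewrite /FracField.mulf !numden_Ratio ?oner_neq0 ?mulr1 ?denom_ratioP//.
by rewrite mulrC.
Qed.

(** * Complex exponentials and derivatives along paths *)

Section Modulus.
Variable R : realType.
Implicit Types z w : R[i].

Lemma complex_eqP z w : Re z = Re w -> Im z = Im w -> z = w.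
Proof. by case: z => a b; case: w => c d /= -> ->. Qed.

Lemma cReD z w : Re (z + w) = Re z + Re w. Proof. by case: z; case: w. Qed.
Lemma cImD z w : Im (z + w) = Im z + Im w. Proof. by case: z; case: w. Qed.
Lemma cReN z : Re (- z) = - Re z. Proof. by case: z. Qed.
Lemma cImN z : Im (- z) = - Im z. Proof. by case: z. Qed.
Lemma cReM z w : Re (z * w) = Re z * Re w - Im z * Im w.
Proof. by case: z; case: w. Qed.
Lemma cImM z w : Im (z * w) = Re z * Im w + Im z * Re w.
Proof. by case: z; case: w. Qed.

Lemma cmodE z : cmod z = ComplexField.Normc.normc z. Proof. by case: z. Qed.
Lemma cmodM z w : cmod (z * w) = cmod z * cmod w.
Proof. by rewrite !cmodE ComplexField.Normc.normcM. Qed.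
Lemma cmodD z w : cmod (z + w) <= cmod z + cmod w.
Proof. by rewrite !cmodE; exact: le_normcD. Qed.
Lemma cmodN z : cmod (- z) = cmod z.
Proof. by rewrite !cmodE; exact: normcN. Qed.
Lemma cmodV z : cmod z^-1 = (cmod z)^-1.
Proof. by rewrite !cmodE ComplexField.Normc.normcV. Qed.
Lemma cmod_ge0 z : 0 <= cmod z. Proof. exact: sqrtr_ge0. Qed.
Lemma cmod0 : cmod (0 : R[i]) = 0.
Proof. by rewrite cmodE ComplexField.Normc.normc0. Qed.
Lemma cmod_eq0 z : (cmod z == 0) = (z == 0).
Proof.
apply/eqP/eqP => [|->]; last exact: cmod0.
by rewrite cmodE; exact: ComplexField.Normc.eq0_normc.
Qed.
Lemma cmod_gt0 z : (0 < cmod z) = (z != 0).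
Proof. by rewrite lt_def cmod_ge0 cmod_eq0 andbT. Qed.
Lemma cmod_sqr z : cmod z ^+ 2 = Re z ^+ 2 + Im z ^+ 2.
Proof. by rewrite sqr_sqrtr// addr_ge0// sqr_ge0. Qed.
Lemma Re_le_cmod z : `|Re z| <= cmod z.
Proof.
rewrite -sqrtr_sqr; apply: ler_wsqrtr; rewrite lerDl; exact: sqr_ge0.
Qed.
Lemma Im_le_cmod z : `|Im z| <= cmod z.
Proof.
rewrite -sqrtr_sqr; apply: ler_wsqrtr; rewrite lerDr; exact: sqr_ge0.
Qed.
Lemma cmod_le z : cmod z <= `|Re z| + `|Im z|.
Proof.
rewrite -(@ler_sqr _ _ _ (cmod_ge0 z)) ?nnegrE ?addr_ge0// cmod_sqr sqrrD.
rewrite !real_normK ?num_real// lerD2r lerDl mulrn_wge0// mulr_ge0//.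
Qed.
Lemma cmod_real (x : R) : cmod x%:C = `|x|.
Proof. by rewrite /cmod /= expr0n/= addr0 sqrtr_sqr. Qed.

Lemma cexpD z w : cexp (z + w) = cexp z * cexp w.
Proof.
apply: complex_eqP; rewrite ?cReM ?cImM /cexp /= cReD cImD expRD ?cosD ?sinD; ring.
Qed.
Lemma cexp0 : cexp 0 = 1 :> R[i].
Proof. by rewrite /cexp /= expR0 cos0 sin0 mul1r mulr0. Qed.
Lemma cmod_cexp z : cmod (cexp z) = expR (Re z).
Proof.
rewrite /cmod /cexp /= !exprMn -mulrDr cos2Dsin2 mulr1 sqrtr_sqr.
by rewrite ger0_norm ?expR_ge0.
Qed.
Lemma cexpMn z n : cexp (n%:R * z) = cexp z ^+ n.
Proof.
elim: n => [|n IH]; first by rewrite mul0r cexp0.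
by rewrite -natr1 mulrDl mul1r cexpD IH exprSr.
Qed.
Lemma cexp_real (x : R) : cexp x%:C = (expR x)%:C.
Proof. by rewrite /cexp /= cos0 sin0 mulr1 mulr0. Qed.
Lemma cexp_2pi_i : cexp (0 +i* (2 * pi)) = 1 :> R[i].
Proof. by rewrite /cexp /= expR0 !mul1r mulr_natl cos2pi sin2pi. Qed.

(** On the positive axis, where the branch is not defined, [carg] is 0 and the identity persists;
    hence [cpowD] asks only for [z != 0]. *)
Lemma clogK z : z != 0 -> cexp (clog z) = z.
Proof.
move=> z0; have m0 : 0 < cmod z by rewrite cmod_gt0.
have q1 : -1 <= Re z / cmod z <= 1.
  by rewrite -ler_norml normrM normfV (gtr0_norm m0) ler_pdivrMr// mul1r Re_le_cmod.
have e : expR (ln (cmod z)) = cmod z by rewrite lnK.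
have s2 : Num.sqrt (1 - (Re z / cmod z) ^+ 2) = `|Im z| / cmod z.
  rewrite -[RHS]ger0_norm ?divr_ge0 ?cmod_ge0// -sqrtr_sqr; congr Num.sqrt.
  rewrite !expr_div_n real_normK ?num_real//.
  apply: (mulIf (_ : cmod z ^+ 2 != 0)); first by rewrite expf_neq0// gt_eqF.
  by rewrite mulrBl !mulfVK ?expf_neq0 ?gt_eqF// mul1r cmod_sqr addrAC subrr add0r.
have cK : cos (acos (Re z / cmod z)) = Re z / cmod z by rewrite acosK.
apply: complex_eqP; rewrite /cexp /clog /= e /carg; case: ifPn => Iz.
- by rewrite cK mulrC mulfVK// gt_eqF.
- by rewrite mulr_natl [pi *+ 2 - _]addrC cosD2pi cosN cK mulrC mulfVK// gt_eqF.
- by rewrite sin_acos// s2 mulrC mulfVK ?gt_eqF// ger0_norm.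
- rewrite mulr_natl [pi *+ 2 - _]addrC sinD2pi sinN sin_acos// s2 mulrN mulrC mulfVK ?gt_eqF//.
  by rewrite ltr0_norm ?opprK// ltNge.
Qed.

Lemma cpowD z a n : z != 0 -> cpow z (a + n%:R) = cpow z a * z ^+ n.
Proof. by move=> z0; rewrite /cpow mulrDl cexpD cexpMn clogK. Qed.

End Modulus.

(** * Derivatives of complex functions of a real variable *)

Section PathDerivative.
Local Open Scope classical_set_scope.
Variable R : realType.
Implicit Types (f g : R -> R[i]) (t : R) (l : R[i]).

Definition cderiv f t l :=
  is_derive t 1 (fun s => Re (f s)) (Re l) /\
  is_derive t 1 (fun s => Im (f s)) (Im l).

Lemma cderiv_eq f t l l' : cderiv f t l -> l = l' -> cderiv f t l'.
Proof. by move=> + <-. Qed.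

Lemma cderiv_cst (z : R[i]) t : cderiv (fun=> z) t 0.
Proof. by split; exact: is_derive_cst. Qed.

Lemma cderiv_real (f : R -> R) t (l : R) : is_derive t 1 f l ->
  cderiv (fun s => (f s)%:C) t l%:C.
Proof. by move=> df; split => //=; exact: is_derive_cst. Qed.

Lemma cderivD f g t lf lg : cderiv f t lf -> cderiv g t lg ->
  cderiv (fun s => f s + g s) t (lf + lg).
Proof.
move=> [f1 f2] [g1 g2]; split.
  rewrite cReD; under eq_fun do rewrite cReD; exact: is_deriveD.
by rewrite cImD; under eq_fun do rewrite cImD; exact: is_deriveD.
Qed.

Lemma cderivN f t lf : cderiv f t lf -> cderiv (fun s => - f s) t (- lf).
Proof.
move=> [f1 f2]; split.
  rewrite cReN; under eq_fun do rewrite cReN; exact: is_deriveN.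
by rewrite cImN; under eq_fun do rewrite cImN; exact: is_deriveN.
Qed.

Lemma cderivM f g t lf lg : cderiv f t lf -> cderiv g t lg ->
  cderiv (fun s => f s * g s) t (lf * g t + f t * lg).
Proof.
move=> [f1 f2] [g1 g2]; split.
  under eq_fun do rewrite cReM.
  have D := is_deriveB (is_deriveM f1 g1) (is_deriveM f2 g2).
  apply: is_derive_eq D _; rewrite /GRing.scale/= cReD !cReM; ring.
under eq_fun do rewrite cImM.
have D := is_deriveD (is_deriveM f1 g2) (is_deriveM f2 g1).
apply: is_derive_eq D _; rewrite /GRing.scale/= cImD !cImM; ring.
Qed.

Lemma cderivZ (z : R[i]) f t l : cderiv f t l -> cderiv (fun s => z * f s) t (z * l).
Proof.
by move=> df; apply: cderiv_eq (cderivM (cderiv_cst z t) df) _; rewrite mul0r add0r.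
Qed.

Lemma cderivV f t lf : cderiv f t lf -> f t != 0 ->
  cderiv (fun s => (f s)^-1) t (- lf / f t ^+ 2).
Proof.
move=> [f1 f2] ft0.
have q0 : Re (f t) ^+ 2 + Im (f t) ^+ 2 != 0.
  by rewrite -cmod_sqr expf_neq0// cmod_eq0.
have dN : is_derive t 1 (fun s => Re (f s) ^+ 2 + Im (f s) ^+ 2)
    (2 * (Re (f t) * Re lf + Im (f t) * Im lf)).
  under eq_fun do rewrite !expr2.
  have D := is_deriveD (is_deriveM f1 f1) (is_deriveM f2 f2).
  by apply: is_derive_eq D _; rewrite /GRing.scale/=; ring.
have dV : is_derive t 1 (fun s => (Re (f s) ^+ 2 + Im (f s) ^+ 2)^-1)
   (- (2 * (Re (f t) * Re lf + Im (f t) * Im lf)) / (Re (f t) ^+ 2 + Im (f t) ^+ 2) ^+ 2).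
  have D := @is_deriveV _ (fun s => Re (f s) ^+ 2 + Im (f s) ^+ 2) t _ 1 q0 dN.
  by apply: is_derive_eq D _; rewrite /GRing.scale/=; ring.
(* The inverse square is the squared conjugate over the fourth power of the modulus, which makes
   real and imaginary parts explicit. *)
have conj2 : f t ^- 2 = (Re (f t) -i* Im (f t)) ^+ 2 * ((Re (f t) ^+ 2 + Im (f t) ^+ 2) ^- 2)%:C.
  apply: (mulfI (_ : f t ^+ 2 != 0)); first by rewrite expf_neq0.
  rewrite divff ?expf_neq0// mulrA -exprMn.
  have -> : f t * (Re (f t) -i* Im (f t)) = (Re (f t) ^+ 2 + Im (f t) ^+ 2)%:C.
    by apply: complex_eqP; rewrite ?cReM ?cImM /=; ring.
  by rewrite -rmorphXn/= -rmorphM/= divff// expf_neq0.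
rewrite conj2.
split.
  have -> : (fun s => Re (f s)^-1) =
     (fun s => Re (f s) * (Re (f s) ^+ 2 + Im (f s) ^+ 2)^-1).
    by apply/funext => s; case: (f s).
  have D := is_deriveM f1 dV.
  apply: is_derive_eq D _; rewrite /GRing.scale/= !expr2 !(cReM, cImM, cReN, cImN)/=.
  by field; rewrite !expr2 in q0.
have -> : (fun s => Im (f s)^-1) =
     (fun s => - Im (f s) * (Re (f s) ^+ 2 + Im (f s) ^+ 2)^-1).
  apply/funext => s; case: (f s) => a b /=; by rewrite mulNr.
have f2' : is_derive t 1 (fun s => - Im (f s)) (- Im lf) := is_deriveN f2.
have D := is_deriveM f2' dV.
apply: is_derive_eq D _; rewrite /GRing.scale/= !expr2 !(cReM, cImM, cReN, cImN)/=.
by field; rewrite !expr2 in q0.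
Qed.

Lemma cderiv_cexp f t l : cderiv f t l ->
  cderiv (fun s => cexp (f s)) t (l * cexp (f t)).
Proof.
move=> [f1 f2].
have dE := is_derive1_comp (is_derive_expR (Re (f t))) f1.
have dC := is_derive1_comp (is_derive_cos (Im (f t))) f2.
have dS := is_derive1_comp (is_derive_sin (Im (f t))) f2.
split.
  have D := is_deriveM dE dC.
  by apply: is_derive_eq D _; rewrite /GRing.scale/= cReM /=; ring.
have D := is_deriveM dE dS.
by apply: is_derive_eq D _; rewrite /GRing.scale/= cImM /=; ring.
Qed.

Lemma cderiv_horner (p : {poly R[i]}) f t l : cderiv f t l ->
  cderiv (fun s => p.[f s]) t (p^`().[f t] * l).
Proof.
move=> df; elim/poly_ind: p => [|p c IH].
  under eq_fun do rewrite horner0; rewrite deriv0 horner0 mul0r; exact: cderiv_cst.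
under eq_fun do rewrite hornerMXaddC.
apply: cderiv_eq (cderivD (cderivM IH df) (cderiv_cst c t)) _.
by rewrite derivD derivM derivC derivX !hornerE; ring.
Qed.

Lemma cderiv_continuous f t l : cderiv f t l ->
  {for t, continuous (fun s => Re (f s))} /\
  {for t, continuous (fun s => Im (f s))}.
Proof.
by move=> [f1 f2]; split; apply: differentiable_continuous;
  apply/derivable1_diffP; [case: f1|case: f2].
Qed.

End PathDerivative.

(** * Complex-valued integrals *)

Section Integrals.
Local Open Scope classical_set_scope.
Variable R : realType.
Local Notation mu := (lebesgue_measure : measure _ R).
Local Notation measurableL := (@measurable _ (measurableTypeR R)).
Local Notation cintegrable := (@cintegrable R).
Implicit Types (D : set R) (f g F : R -> R[i]).

Lemma Rintegral_segment (f F : R -> R) (a b : R) : a < b ->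
  (forall x, a <= x <= b -> is_derive x 1 F (f x)) ->
  (forall x, a <= x <= b -> {for x, continuous f}) ->
  Rintegral mu `[a, b] f = F b - F a.
Proof.
move=> ab dF cf.
have cF x : a <= x <= b -> {for x, continuous F}.
  move=> /dF [d _]; apply: differentiable_continuous; exact/derivable1_diffP.
rewrite /Rintegral (@continuous_FTC2 _ f F a b)//.
- apply: continuous_in_subspaceT => x; rewrite inE/= in_itv/=; exact: cf.
- split.
  + move=> x; rewrite in_itv/= => /andP[ax xb].
    by have [] := dF x (_ : a <= x <= b); rewrite ?(ltW ax) ?(ltW xb).
  + by apply: cvg_at_right_filter; apply: cF; rewrite lexx ltW.
  + by apply: cvg_at_left_filter; apply: cF; rewrite lexx andbT ltW.
- move=> x; rewrite in_itv/= => /andP[ax xb]; rewrite derive1E.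
  by have [] := dF x (_ : a <= x <= b); rewrite ?(ltW ax) ?(ltW xb).
Qed.

(** The fundamental theorem on each segment, then dominated convergence: the restrictions of [f] to
    the segments are dominated by |f|. *)
Lemma Rintegral_exhaust D (f F : R -> R) (a b : nat -> R) :
  measurableL D -> mu.-integrable D (EFin \o f) ->
  (forall n, a n < b n) -> (forall n, `[a n, b n] `<=` D) ->
  (forall x, D x -> \forall n \near \oo, a n <= x <= b n) ->
  (forall x, D x -> is_derive x 1 F (f x)) ->
  (forall x, D x -> {for x, continuous f}) ->
  F (b n) - F (a n) @[n --> \oo] --> Rintegral mu D f.
Proof.
move=> mD intf ab abD nearD dF cf.
have mf : measurable_fun D f.
  by apply/measurable_EFinP; exact: (measurable_int mu intf).
have seg n : Rintegral mu `[a n, b n] f = F (b n) - F (a n).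
  by apply: Rintegral_segment => // x xab; [apply: dF|apply: cf];
    apply: (abD n); rewrite /= in_itv.
pose fn n := EFin \o (f \_ `[a n, b n]).
have intn n : mu.-integrable D (fn n).
  rewrite /fn -restrict_EFin; apply/integrable_restrict => //.
  by apply: (integrableS mD) => //; apply: measurableI.
have [] := @dominated_convergence _ _ _ mu D mD fn (EFin \o f) (abse \o (EFin \o f)).
- by move=> n; exact: (measurable_int mu (intn n)).
- exact/measurable_EFinP.
- apply: aeW => x Dx; apply: cvg_near_cst.
  have := nearD x Dx; apply: filterS => n xab.
  by rewrite /fn /= patchE mem_set//= in_itv.
- exact: integrable_abse.
- apply: aeW => x n Dx; rewrite /fn /= patchE; case: ifP => // _.
  by rewrite normr0 lee_fin.
move=> _ _ C.
have {}C : Rintegral mu D (f \_ `[a n, b n]) @[n --> \oo] --> Rintegral mu D f.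
  apply: fine_cvg; rewrite -/(Rintegral mu D f) /Rintegral fineK//.
  exact: integrable_fin_num.
apply: cvg_trans C; apply: near_eq_cvg; apply: nearW => n.
rewrite -seg -Rintegral_mkcondr; congr (Rintegral mu _ f).
by apply/setIidPr.
Qed.

Definition ccvg (u : nat -> R[i]) (v : R[i]) :=
  (Re (u n) @[n --> \oo] --> Re v) /\ (Im (u n) @[n --> \oo] --> Im v).

Lemma ccvg_unique u v w : ccvg u v -> ccvg u w -> v = w.
Proof.
move=> [v1 v2] [w1 w2]; apply: complex_eqP.
  by rewrite -(cvg_lim (@Rhausdorff R) v1) -(cvg_lim (@Rhausdorff R) w1).
by rewrite -(cvg_lim (@Rhausdorff R) v2) -(cvg_lim (@Rhausdorff R) w2).
Qed.

Lemma ccvg_cst z : ccvg (fun=> z) z.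
Proof. by split; exact: cvg_cst. Qed.

Lemma ccvgD u1 u2 v1 v2 : ccvg u1 v1 -> ccvg u2 v2 ->
  ccvg (fun n => u1 n + u2 n) (v1 + v2).
Proof.
move=> [a1 a2] [b1 b2]; split.
  by rewrite cReD; under eq_fun do rewrite cReD; exact: cvgD.
by rewrite cImD; under eq_fun do rewrite cImD; exact: cvgD.
Qed.

Lemma ccvgZ z u v : ccvg u v -> ccvg (fun n => z * u n) (z * v).
Proof.
move=> [u1 u2]; split.
  rewrite cReM; under eq_fun do rewrite cReM.
  by apply: cvgB; apply: cvgM => //; exact: cvg_cst.
rewrite cImM; under eq_fun do rewrite cImM.
by apply: cvgD; apply: cvgM => //; exact: cvg_cst.
Qed.

Lemma ccvg0 (u : nat -> R[i]) (v : nat -> R) :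
  (forall n, cmod (u n) <= v n) -> v n @[n --> \oo] --> (0 : R) -> ccvg u 0.
Proof.
move=> uv v0; have nv0 : - v n @[n --> \oo] --> (0 : R) by rewrite -oppr0; exact: cvgN.
split; apply: squeeze_cvgr nv0 v0; apply: nearW => n.
  by rewrite -ler_norml (le_trans (Re_le_cmod _)).
by rewrite -ler_norml (le_trans (Im_le_cmod _)).
Qed.

Lemma cintegral_exhaust D f F (a b : nat -> R) :
  measurableL D -> cintegrable D f ->
  (forall n, a n < b n) -> (forall n, `[a n, b n] `<=` D) ->
  (forall x, D x -> \forall n \near \oo, a n <= x <= b n) ->
  (forall x, D x -> cderiv F x (f x)) ->
  (forall x, D x -> exists l, cderiv f x l) ->
  ccvg (fun n => F (b n) - F (a n)) (cintegral D f).
Proof.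
move=> mD [i1 i2] ab abD nearD dF df; split.
  under eq_fun do rewrite cReD cReN.
  apply: (@Rintegral_exhaust D _ (fun t => Re (F t)) a b mD i1 ab abD nearD) => x Dx.
    by case: (dF x Dx).
  by have [l /cderiv_continuous[]] := df x Dx.
under eq_fun do rewrite cImD cImN.
apply: (@Rintegral_exhaust D _ (fun t => Im (F t)) a b mD i2 ab abD nearD) => x Dx.
  by case: (dF x Dx).
by have [l /cderiv_continuous[]] := df x Dx.
Qed.

Lemma cintegral_segment (a b : R) f F : a < b ->
  (forall x, a <= x <= b -> cderiv F x (f x)) ->
  (forall x, a <= x <= b -> exists l, cderiv f x l) ->
  cintegral `[a, b] f = F b - F a.
Proof.
move=> ab dF df; apply: complex_eqP; rewrite ?(cReD, cReN, cImD, cImN) /=.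
  apply: (@Rintegral_segment _ (fun t => Re (F t))) => // x Dx; first by case: (dF x Dx).
  by have [l /cderiv_continuous[]] := df x Dx.
apply: (@Rintegral_segment _ (fun t => Im (F t))) => // x Dx; first by case: (dF x Dx).
by have [l /cderiv_continuous[]] := df x Dx.
Qed.

Lemma cintegrable_segment (a b : R) f :
  (forall x, a <= x <= b -> exists l, cderiv f x l) ->
  cintegrable `[a, b] f.
Proof.
move=> df; split; apply: continuous_compact_integrable;
  do ?[exact: segment_compact]; apply: continuous_in_subspaceT => x;
  by rewrite inE/= in_itv/= => /df [l /cderiv_continuous[]].
Qed.

Lemma eq_cintegrable D f g : measurableL D -> {in D, f =1 g} ->
  cintegrable D f -> cintegrable D g.
Proof.
move=> mD fg [i1 i2]; split; [apply: eq_integrable i1|apply: eq_integrable i2] => //;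
  by move=> x Dx /=; rewrite fg.
Qed.

Lemma eq_cintegral D f g : {in D, f =1 g} -> cintegral D f = cintegral D g.
Proof.
by move=> fg; rewrite /cintegral; congr (_ +i* _); apply: eq_Rintegral => x Dx; rewrite fg.
Qed.

Lemma cintegrableD D f g : measurableL D -> cintegrable D f -> cintegrable D g ->
  cintegrable D (fun t => f t + g t).
Proof.
move=> mD [f1 f2] [g1 g2]; split.
  apply: eq_integrable (integrableD mD f1 g1) => //.
  by move=> x _ /=; rewrite cReD EFinD.
apply: eq_integrable (integrableD mD f2 g2) => //.
by move=> x _ /=; rewrite cImD EFinD.
Qed.

Lemma cintegralD D f g : measurableL D -> cintegrable D f -> cintegrable D g ->
  cintegral D (fun t => f t + g t) = cintegral D f + cintegral D g.
Proof.
move=> mD [f1 f2] [g1 g2]; apply: complex_eqP; rewrite ?cReD ?cImD /=.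
  by rewrite -RintegralD//; apply: eq_Rintegral => x _; rewrite cReD.
by rewrite -RintegralD//; apply: eq_Rintegral => x _; rewrite cImD.
Qed.

Lemma cintegrableZ D (z : R[i]) f : measurableL D -> cintegrable D f ->
  cintegrable D (fun t => z * f t).
Proof.
move=> mD [f1 f2]; split.
  apply: eq_integrable (integrableB mD (integrableZl mD (Re z) f1) (integrableZl mD (Im z) f2)) => //.
  by move=> x _ /=; rewrite cReM EFinB !EFinM.
apply: eq_integrable (integrableD mD (integrableZl mD (Re z) f2) (integrableZl mD (Im z) f1)) => //.
by move=> x _ /=; rewrite cImM EFinD !EFinM.
Qed.

Lemma cintegralZ D (z : R[i]) f : measurableL D -> cintegrable D f ->
  cintegral D (fun t => z * f t) = z * cintegral D f.
Proof.
move=> mD [f1 f2]; apply: complex_eqP; rewrite ?cReM ?cImM /=.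
  rewrite -!RintegralZl// -RintegralB//.
  - by apply: eq_Rintegral => x _; rewrite cReM.
  - exact: (integrableZl mD (Re z) f1).
  - exact: (integrableZl mD (Im z) f2).
rewrite -!RintegralZl// -RintegralD//.
- by apply: eq_Rintegral => x _; rewrite cImM.
- exact: (integrableZl mD (Re z) f2).
- exact: (integrableZl mD (Im z) f1).
Qed.

Lemma cderiv_measurable D f : measurableL D ->
  (forall x, D x -> exists l, cderiv f x l) ->
  measurable_fun D (fun x => Re (f x)) /\ measurable_fun D (fun x => Im (f x)).
Proof.
by move=> mD df; split; apply: subspace_continuous_measurable_fun => //;
  apply: continuous_in_subspaceT => x; rewrite inE => /df [l /cderiv_continuous[]].
Qed.

Lemma le_cintegrable D f (g : R -> R) : measurableL D ->
  (forall x, D x -> exists l, cderiv f x l) ->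
  mu.-integrable D (EFin \o g) -> (forall x, D x -> cmod (f x) <= g x) ->
  cintegrable D f.
Proof.
move=> mD df ig fg; have [m1 m2] := cderiv_measurable mD df.
split; apply: le_integrable ig => //; try exact/measurable_EFinP;
  move=> x Dx; rewrite /= lee_fin (le_trans _ (ler_norm _))// (le_trans _ (fg x Dx))//.
  exact: Re_le_cmod.
exact: Im_le_cmod.
Qed.

(** A multiple of the density of the exponential law. *)
Lemma integrable_expR_half_line (c k : R) : 0 < k ->
  mu.-integrable `[0, +oo[ (EFin \o (fun x => c * expR (- k * x))).
Proof.
move=> k0.
have mD : measurableL `[0, +oo[ by exact: measurable_itv.
have I : mu.-integrable `[0, +oo[ (EFin \o exponential_pdf k).
  exact: (integrableS measurableT mD (@subsetT _ _) (integrable_exponential_pdf k0)).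
have := integrableZl mD (c / k) I.
apply: eq_integrable => // x; rewrite inE => x0.
rewrite /= /exponential_pdf patchE mem_set// -EFinM; congr EFin.
by rewrite mulrA mulfVK// gt_eqF.
Qed.

(** Monotone convergence: for a nonnegative function a bounded primitive already gives
    integrability, with no dominating function known in advance. *)
Lemma ge0_integrable_exhaust D (f F : R -> R) (a b : nat -> R) (K : R) :
  (forall x, D x -> 0 <= f x) -> (forall n, a n < b n) ->
  (forall n, a n.+1 <= a n) -> (forall n, b n <= b n.+1) ->
  (forall n, `[a n, b n] `<=` D) ->
  (forall x, D x -> exists n, a n <= x <= b n) ->
  (forall x, D x -> is_derive x 1 F (f x)) ->
  (forall x, D x -> {for x, continuous f}) ->
  (forall n, F (b n) - F (a n) <= K) ->
  measurableL D -> mu.-integrable D (EFin \o f).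
Proof.
move=> f0 ab aS bS abD Dab dF cf FK mD.
have DE : \bigcup_n `[a n, b n]%classic = D.
  apply/seteqP; split=> [x [n _] /abD//|x /Dab [n xab]].
  by exists n => //; rewrite /= in_itv.
have mfs n : measurable_fun `[a n, b n] (EFin \o f).
  apply/measurable_EFinP; apply: subspace_continuous_measurable_fun => //.
  by apply: continuous_in_subspaceT => x; rewrite inE => /abD /cf.
have mf : measurable_fun D (EFin \o f).
  apply/measurable_EFinP; apply: subspace_continuous_measurable_fun => //.
  by apply: continuous_in_subspaceT => x; rewrite inE => /cf.
have nd : nondecreasing_seq (fun n => `[a n, b n]%classic).
  apply/nondecreasing_seqP => n; apply/subsetPset => x /=.
  rewrite !in_itv/= => /andP[ax xb].
  by rewrite (le_trans (aS n) ax) (le_trans xb (bS n)).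
have mseg n : measurableL `[a n, b n] by exact: measurable_itv.
have C := @ge0_nondecreasing_set_cvg_integral _ (measurableTypeR R) R
  (fun n => `[a n, b n]%classic) (EFin \o f) mu nd mseg mfs
  (fun n x nx => f0 x (abD n x nx)).
apply/integrableP; split=> //.
have -> : (\int[mu]_(x in D) `|(EFin \o f) x| = \int[mu]_(x in D) (EFin \o f) x)%E.
  by apply: eq_integral => x; rewrite inE => Dx; rewrite /= ger0_norm// f0.
rewrite DE in C.
apply: (@le_lt_trans _ _ K%:E); last exact: ltry.
rewrite -(cvg_lim _ C)//; apply: lime_le; first by apply/cvg_ex; eexists; exact: C.
apply: nearW => n.
have <- : ((fine (\int[mu]_(x in `[a n, b n]) (EFin \o f) x))%:E =
    \int[mu]_(x in `[a n, b n]) (EFin \o f) x)%E.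
  rewrite fineK//; apply: integrable_fin_num => //.
  apply: continuous_compact_integrable; first exact: segment_compact.
  by apply: continuous_in_subspaceT => x; rewrite inE => /abD /cf.
have seg : Rintegral mu `[a n, b n] f = F (b n) - F (a n).
  by apply: Rintegral_segment => // x xab; [apply: dF|apply: cf];
    apply: (abD n); rewrite /= in_itv.
by rewrite lee_fin -[leLHS]/(Rintegral mu `[a n, b n] f) seg.
Qed.

(** The factor 2 comes from bounding real and imaginary parts separately; only boundedness matters
    later. *)
Lemma cmod_cintegral_le D f (g : R -> R) : measurableL D -> cintegrable D f ->
  mu.-integrable D (EFin \o g) -> (forall x, D x -> cmod (f x) <= g x) ->
  cmod (cintegral D f) <= 2 * Rintegral mu D g.
Proof.
move=> mD [i1 i2] ig fg; rewrite (le_trans (cmod_le _))//= mulr_natl mulr2n lerD//.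
  apply: (le_trans (le_normr_Rintegral mD i1)); apply: le_Rintegral => //.
    exact: integrable_norm.
  by move=> x Dx; rewrite (le_trans (Re_le_cmod _))// fg.
apply: (le_trans (le_normr_Rintegral mD i2)); apply: le_Rintegral => //.
  exact: integrable_norm.
by move=> x Dx; rewrite (le_trans (Im_le_cmod _))// fg.
Qed.

End Integrals.

(** * The path Lambda_r in logarithmic coordinates *)

Section Contour.
Local Open Scope classical_set_scope.
Variable R : realType.
Local Notation measurableL := (@measurable _ (measurableTypeR R)).
Local Notation cintegrable := (@cintegrable R).
Implicit Types (f g : R[i] -> R[i]) (l : R -> R[i]).

(** [is_Lambda_integral] couples convergence and value. Here they are separated, so that the value
    can be computed with as a function of the integrand. *)
Definition Lint (r : R) g : R[i] :=
  - cintegral `[0, +oo[ (fun x => g (half_line_up r x))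
  + cintegral `[pi / 2, 3 * pi / 2]
      (fun t => g (left_arc r t) * ((- (r * sin t)) +i* (r * cos t)))
  + cintegral `[0, +oo[ (fun x => g (half_line_down r x)).

Definition Lable (r : R) g : Prop :=
  [/\ cintegrable `[0, +oo[ (fun x => g (half_line_up r x)),
      cintegrable `[pi / 2, 3 * pi / 2]
        (fun t => g (left_arc r t) * ((- (r * sin t)) +i* (r * cos t))) &
      cintegrable `[0, +oo[ (fun x => g (half_line_down r x))].

Lemma is_Lambda_integralP r g v :
  Lable r g -> Lint r g = v -> is_Lambda_integral r g v.
Proof. by move=> [? ? ?] ?; split. Qed.

Let mH : measurableL `[0, +oo[. Proof. exact: measurable_itv. Qed.
Let mA : measurableL `[pi / 2, 3 * pi / 2]. Proof. exact: measurable_itv. Qed.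

Lemma LintD r f g : Lable r f -> Lable r g ->
  Lint r (fun z => f z + g z) = Lint r f + Lint r g.
Proof.
move=> [f1 f2 f3] [g1 g2 g3]; rewrite /Lint !cintegralD//.
have -> : (fun t => (f (left_arc r t) + g (left_arc r t)) *
      ((- (r * sin t)) +i* (r * cos t))) =
   (fun t => f (left_arc r t) * ((- (r * sin t)) +i* (r * cos t)) +
             g (left_arc r t) * ((- (r * sin t)) +i* (r * cos t))).
  by apply/funext => t; rewrite mulrDl.
by rewrite cintegralD//; ring.
Qed.

Lemma LintZ r z0 f : Lable r f -> Lint r (fun z => z0 * f z) = z0 * Lint r f.
Proof.
move=> [f1 f2 f3]; rewrite /Lint !cintegralZ//.
have -> : (fun t => z0 * f (left_arc r t) *
      ((- (r * sin t)) +i* (r * cos t))) =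
   (fun t => z0 * (f (left_arc r t) * ((- (r * sin t)) +i* (r * cos t)))).
  by apply/funext => t; rewrite mulrA.
by rewrite cintegralZ//; ring.
Qed.

Lemma LableZ r z0 f : Lable r f -> Lable r (fun z => z0 * f z).
Proof.
move=> [f1 f2 f3]; split; [exact: cintegrableZ| |exact: cintegrableZ].
apply: eq_cintegrable (cintegrableZ z0 mA f2) => // t _.
by rewrite mulrA.
Qed.

Variable r : R.
Hypothesis r0 : 0 < r.

(** The logarithm along each piece as an elementary function of the parameter, which is easier to
    differentiate than [carg]. *)
Definition ray_up_log (t : R) : R[i] := (ln (t ^+ 2 + r ^+ 2) / 2) +i* (pi / 2 - atan (t / r)).
Definition ray_down_log (t : R) : R[i] :=
  (ln (t ^+ 2 + r ^+ 2) / 2) +i* (3 * pi / 2 + atan (t / r)).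
Definition arc_log (t : R) : R[i] := ln r +i* t.

Lemma sumsqr_gt0 t : 0 < t ^+ 2 + r ^+ 2.
Proof. by rewrite ltr_wpDl ?sqr_ge0// exprn_gt0. Qed.

Lemma ln_sqrt_half (q : R) : 0 < q -> ln (Num.sqrt q) = ln q / 2.
Proof.
move=> q0; have s0 : 0 < Num.sqrt q by rewrite sqrtr_gt0.
apply: (mulIf (_ : 2 != 0 :> R)) => //; rewrite mulfVK// -{2}(sqr_sqrtr (ltW q0)).
by rewrite lnXn// mulr_natr.
Qed.

Lemma sin_atan_div t : sin (atan (t / r)) = t / Num.sqrt (t ^+ 2 + r ^+ 2).
Proof.
have c0 : cos (atan (t / r)) != 0.
  by rewrite cos_atan invr_neq0// gt_eqF// sqrtr_gt0 ltr_wpDr// sqr_ge0.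
have -> : sin (atan (t / r)) = tan (atan (t / r)) * cos (atan (t / r)).
  by rewrite /tan mulfVK.
rewrite atanK cos_atan.
have -> : t ^+ 2 + r ^+ 2 = (1 + (t / r) ^+ 2) * r ^+ 2.
  by field; rewrite gt_eqF.
rewrite sqrtrM ?addr_ge0 ?sqr_ge0// sqrtr_sqr gtr0_norm// invfM.
by rewrite [_^-1 * r^-1]mulrC mulrA.
Qed.

Lemma clog_up t : clog (half_line_up r t) = ray_up_log t.
Proof.
rewrite /clog /ray_up_log; congr (_ +i* _); first by rewrite /cmod /= ln_sqrt_half// sumsqr_gt0.
rewrite /carg /half_line_up /= (ltW r0) /cmod /= -sin_atan_div -cosBpihalf -cosN opprB cosK//.
have := atan_gtNpi2 (t / r); have := atan_ltpi2 (t / r); rewrite in_itv/=; lra.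
Qed.

Lemma clog_down t : clog (half_line_down r t) = ray_down_log t.
Proof.
rewrite /clog /ray_down_log; congr (_ +i* _).
  by rewrite /cmod /= sqrrN ln_sqrt_half// sumsqr_gt0.
rewrite /carg /half_line_down /= oppr_ge0 leNgt r0 /= /cmod /= sqrrN.
rewrite -sin_atan_div -cosBpihalf -cosN opprB cosK//; first by field.
have := atan_gtNpi2 (t / r); have := atan_ltpi2 (t / r); rewrite in_itv/=; lra.
Qed.

Lemma cmod_arc t : cmod (left_arc r t) = r.
Proof.
rewrite /cmod /left_arc /= !exprMn -mulrDr cos2Dsin2 mulr1 sqrtr_sqr.
by rewrite gtr0_norm.
Qed.

Lemma clog_arc t : pi / 2 <= t <= 3 * pi / 2 -> clog (left_arc r t) = arc_log t.
Proof.
move=> /andP[t1 t2]; rewrite /clog /carg cmod_arc /arc_log; congr (_ +i* _).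
rewrite /left_arc /= mulrAC divff ?gt_eqF// mul1r pmulr_rge0//.
have := @pi_gt0 R => pi0.
have [tpi|tpi] := leP t pi.
  by rewrite sin_ge0_pi ?cosK ?in_itv/=; lra.
have st : sin t < 0.
  have -> : t = (t - pi) + pi by rewrite subrK.
  by rewrite sinDpi oppr_lt0 sin_gt0_pi//; lra.
rewrite leNgt st /= -[cos t]cosN -[- t](addrK (pi *+ 2)).
have -> : cos (- t + pi *+ 2 - pi *+ 2) = cos (2 * pi - t).
  by rewrite addrK mulr_natl [pi *+ 2 - t]addrC cosD2pi.
by rewrite cosK ?in_itv/=; lra.
Qed.

(** The second condition makes integrands along the curve continuous and the speed locally
    bounded. *)
Definition smooth l l' :=
  forall t, cderiv l t (l' t) /\ exists d, cderiv l' t d.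

Lemma up_neq0 t : half_line_up r t != 0.
Proof. by rewrite eq_complex /= [r == 0]gt_eqF// andbF. Qed.

Lemma down_neq0 t : half_line_down r t != 0.
Proof. by rewrite eq_complex /= oppr_eq0 [r == 0]gt_eqF// andbF. Qed.

Lemma arc_neq0 t : left_arc r t != 0.
Proof. by rewrite -cmod_eq0 cmod_arc gt_eqF. Qed.

Lemma exp_up t : cexp (ray_up_log t) = half_line_up r t.
Proof. by rewrite -clog_up clogK// up_neq0. Qed.

Lemma exp_down t : cexp (ray_down_log t) = half_line_down r t.
Proof. by rewrite -clog_down clogK// down_neq0. Qed.

Lemma exp_arc t : cexp (arc_log t) = left_arc r t.
Proof. by rewrite /cexp /arc_log /= lnK. Qed.

Lemma cderiv_up t : cderiv (half_line_up r) t 1.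
Proof. by split => /=; [exact: is_derive_id|exact: is_derive_cst]. Qed.

Lemma cderiv_down t : cderiv (half_line_down r) t 1.
Proof. by split => /=; [exact: is_derive_id|exact: is_derive_cst]. Qed.

Lemma is_derive_half_ln (t : R) :
  is_derive t 1 (fun t => ln (t ^+ 2 + r ^+ 2) / 2) (t / (t ^+ 2 + r ^+ 2)).
Proof.
have d1 : is_derive t 1 (fun s : R => s ^+ 2 + r ^+ 2) (2 * t).
  under eq_fun do rewrite expr2.
  have did : is_derive t 1 (fun s : R => s) 1 by exact: is_derive_id.
  have dcs : is_derive t 1 (fun=> r ^+ 2) 0 by exact: is_derive_cst.
  have D := is_deriveD (is_deriveM did did) dcs.
  by apply: is_derive_eq D _; rewrite /GRing.scale/=; ring.
have dcs : is_derive t 1 (fun=> 2^-1 : R) 0 by exact: is_derive_cst.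
have D := is_deriveM (@is_derive1_comp _ (@ln R) (fun s : R => s ^+ 2 + r ^+ 2) t _ _
  (is_derive1_ln (sumsqr_gt0 t)) d1) dcs.
apply: is_derive_eq D _; rewrite /GRing.scale/=.
by field; rewrite gt_eqF// sumsqr_gt0.
Qed.

Lemma is_derive_atan_div (t : R) :
  is_derive t 1 (fun t => atan (t / r)) (r / (t ^+ 2 + r ^+ 2)).
Proof.
have d1 : is_derive t 1 (fun s : R => s / r) r^-1.
  have did : is_derive t 1 (fun s : R => s) 1 by exact: is_derive_id.
  have dcs : is_derive t 1 (fun=> r^-1) 0 by exact: is_derive_cst.
  have D := is_deriveM did dcs.
  by apply: is_derive_eq D _; rewrite /GRing.scale/=; ring.
have D := @is_derive1_comp _ (@atan R) (fun s : R => s / r) t _ _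
  (is_derive1_atan (t / r)) d1.
apply: is_derive_eq D _.
have := sumsqr_gt0 t => q0; field.
by rewrite !gt_eqF//= addrC.
Qed.

Lemma smooth_up : smooth ray_up_log (fun t => (half_line_up r t)^-1).
Proof.
move=> t; split; last first.
  by eexists; apply: cderivV (cderiv_up t) (up_neq0 t).
split => /=; first exact: is_derive_half_ln.
have dcs : is_derive t 1 (fun=> pi / 2 : R) 0 by exact: is_derive_cst.
have D := is_deriveB dcs (is_derive_atan_div t).
by apply: is_derive_eq D _; rewrite sub0r.
Qed.

Lemma smooth_down : smooth ray_down_log (fun t => (half_line_down r t)^-1).
Proof.
move=> t; split; last first.
  by eexists; apply: cderivV (cderiv_down t) (down_neq0 t).
split => /=; first by rewrite sqrrN; exact: is_derive_half_ln.
have dcs : is_derive t 1 (fun=> 3 * pi / 2 : R) 0 by exact: is_derive_cst.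
have D := is_deriveD dcs (is_derive_atan_div t).
by apply: is_derive_eq D _; rewrite add0r sqrrN mulNr opprK.
Qed.

Lemma smooth_arc (rho : R) : smooth (fun t => rho +i* t) (fun=> 'i).
Proof.
move=> t; split; last by exists 0; exact: cderiv_cst.
by split => /=; [exact: is_derive_cst|exact: is_derive_id].
Qed.


(** [F] is a primitive of f dz in the variable w = log z, where dz = e^w dw, tested along all smooth
    curves outside the disc of radius r. *)
Definition primitive_on (f F : R[i] -> R[i]) := forall l l', smooth l l' ->
  forall t, r <= cmod (cexp (l t)) ->
  cderiv (fun s => F (l s)) t (f (l t) * (l' t * cexp (l t))).

Definition differentiable_on (f : R[i] -> R[i]) := forall l l', smooth l l' ->
  forall t, r <= cmod (cexp (l t)) -> exists d, cderiv (fun s => f (l s)) t d.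

Lemma r_le_up t : r <= cmod (half_line_up r t).
Proof. by apply: le_trans (Im_le_cmod _); rewrite /= ler_norm. Qed.

Lemma r_le_down t : r <= cmod (half_line_down r t).
Proof. by apply: le_trans (Im_le_cmod _); rewrite /= normrN ler_norm. Qed.

Lemma cintegral_half_line (f F : R -> R[i]) (v : R[i]) :
  cintegrable `[0, +oo[ f ->
  (forall x, cderiv F x (f x)) -> (forall x, exists d, cderiv f x d) ->
  ccvg (fun n => F n.+1%:R) v -> cintegral `[0, +oo[ f = v - F 0.
Proof.
move=> fi dF df Fv.
have mD : measurableL `[0, +oo[ by exact: measurable_itv.
have C : ccvg (fun n => F n.+1%:R - F 0) (cintegral `[0, +oo[ f).
  apply: (@cintegral_exhaust _ _ f F (fun=> 0) (fun n => n.+1%:R)) => //.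
    by move=> n x; rewrite /= !in_itv/= andbT => /andP[].
  move=> x; rewrite /= in_itv/= andbT => x0.
  exists (Num.truncn x).+1 => // n /= xn; rewrite x0/=.
  apply/ltW/(lt_le_trans (truncnS_gt x)); rewrite ler_nat.
  by rewrite (leq_trans xn).
exact: (ccvg_unique C (ccvgD Fv (ccvg_cst (- F 0)))).
Qed.

(** The values of the primitive at the two joins i r and -i r cancel, which leaves its limits at the
    two infinite ends. *)
Lemma Lint_primitive f F g (u v : R[i]) :
  primitive_on f F -> differentiable_on f -> (forall z, z != 0 -> g z = f (clog z)) ->
  cintegrable `[0, +oo[ (fun x => g (half_line_up r x)) ->
  cintegrable `[0, +oo[ (fun x => g (half_line_down r x)) ->
  ccvg (fun n => F (ray_up_log n.+1%:R)) u ->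
  ccvg (fun n => F (ray_down_log n.+1%:R)) v ->
  Lable r g /\ Lint r g = v - u.
Proof.
move=> Ff df gE iu id Fu Fv; have pi0 := @pi_gt0 R.
have pi23 : pi / 2 < 3 * pi / 2 :> R by lra.
have up : cintegral `[0, +oo[ (fun x => g (half_line_up r x)) = u - F (ray_up_log 0).
  apply: (@cintegral_half_line _ (fun t => F (ray_up_log t))) => // x.
    have := Ff _ _ smooth_up x; rewrite exp_up => /(_ (r_le_up x)) D.
    by apply: cderiv_eq D _; rewrite mulVf ?up_neq0// mulr1 gE ?up_neq0// clog_up.
  have := df _ _ smooth_up x; rewrite exp_up => /(_ (r_le_up x)) [d D].
  by exists d; under eq_fun do rewrite (gE _ (up_neq0 _)) clog_up.
have down : cintegral `[0, +oo[ (fun x => g (half_line_down r x)) = v - F (ray_down_log 0).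
  apply: (@cintegral_half_line _ (fun t => F (ray_down_log t))) => // x.
    have := Ff _ _ smooth_down x; rewrite exp_down => /(_ (r_le_down x)) D.
    by apply: cderiv_eq D _; rewrite mulVf ?down_neq0// mulr1 gE ?down_neq0// clog_down.
  have := df _ _ smooth_down x; rewrite exp_down => /(_ (r_le_down x)) [d D].
  by exists d; under eq_fun do rewrite (gE _ (down_neq0 _)) clog_down.
pose fa t := f (arc_log t) * ('i * cexp (arc_log t)).
have faE : {in `[pi / 2, 3 * pi / 2], fa =1
    (fun t => g (left_arc r t) * ((- (r * sin t)) +i* (r * cos t)))}.
  move=> t; rewrite inE/= in_itv/= => tp.
  rewrite /fa gE ?arc_neq0// clog_arc// exp_arc; congr (_ * _).
  by apply: complex_eqP; rewrite ?cReM ?cImM /=; ring.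
have dfa t : exists d, cderiv fa t d.
  have ra : r <= cmod (cexp (arc_log t)) by rewrite exp_arc cmod_arc.
  have [d D] := df _ _ (smooth_arc (ln r)) t ra.
  have [da _] := smooth_arc (ln r) t.
  eexists; exact: (cderivM D (cderivZ 'i (cderiv_cexp da))).
have arc : cintegral `[pi / 2, 3 * pi / 2] fa =
    F (arc_log (3 * pi / 2)) - F (arc_log (pi / 2)).
  apply: (@cintegral_segment _ _ _ fa (fun t => F (arc_log t))) => // t _.
  have ra : r <= cmod (cexp (arc_log t)) by rewrite exp_arc cmod_arc.
  exact: (Ff _ _ (smooth_arc (ln r)) t ra).
split.
  split=> //; apply: eq_cintegrable faE _ => //.
  by apply: cintegrable_segment => t _; exact: dfa.
rewrite /Lint up down -(eq_cintegral faE) arc.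
have -> : ray_up_log 0 = arc_log (pi / 2).
  rewrite /ray_up_log /arc_log mul0r atan0 subr0 expr0n/= add0r lnXn//.
  by congr (_ +i* _); rewrite -[ln r *+ 2]mulr_natr mulfK.
have -> : ray_down_log 0 = arc_log (3 * pi / 2).
  rewrite /ray_down_log /arc_log mul0r atan0 addr0 expr0n/= add0r lnXn//.
  by congr (_ +i* _); rewrite -[ln r *+ 2]mulr_natr mulfK.
ring.
Qed.

End Contour.

(** * Integrals of rational functions against z^a e^(-z) *)

Section Weight.
Local Open Scope classical_set_scope.
Variable R : realType.
Local Notation measurableL := (@measurable _ (measurableTypeR R)).
Local Notation cintegrable := (@cintegrable R).
Implicit Types (P S : {poly R[i]}) (a w z : R[i]).

(** By induction with half the rate: the other half absorbs the extra factor through |z| <= (2/e)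
    e^(e|z|/2). *)
Lemma poly_growth P (e : R) : 0 < e ->
  exists2 A, 0 <= A & forall z, cmod P.[z] <= A * expR (e * cmod z).
Proof.
elim/poly_ind: P e => [|P c IH] e e0.
  by exists 0 => // z; rewrite horner0 cmod0 mul0r.
have e2 : 0 < e / 2 by rewrite divr_gt0.
have [A A0 PA] := IH _ e2.
exists (A * (2 / e) + cmod c).
  by apply: addr_ge0 (cmod_ge0 c); apply: mulr_ge0 => //; apply: divr_ge0 => //; exact: ltW.
move=> z; rewrite hornerMXaddC (le_trans (cmodD _ _))// mulrDl lerD//.
  rewrite cmodM.
  have -> : expR (e * cmod z) = expR (e / 2 * cmod z) * expR (e / 2 * cmod z).
    by rewrite -expRD -mulrDl -splitr.
  rewrite mulrACA ler_pM ?cmod_ge0//.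
  rewrite -ler_pdivrMl ?divr_gt0// invf_div.
  by apply: le_trans (expR_ge1Dx _); rewrite lerDr.
by rewrite ler_peMr ?cmod_ge0// -[leLHS]expR0 ler_expR mulr_ge0 ?cmod_ge0 ?ltW.
Qed.

Lemma ln_abs_bound (d r : R) : 0 < d -> 0 < r ->
  exists C, forall m, r <= m -> `|ln m| <= d * m + C.
Proof.
move=> d0 r0; exists (`|ln d| + `|ln r|) => m rm.
have m0 : 0 < m by apply: lt_le_trans rm.
rewrite ler_norml; apply/andP; split.
  rewrite lerNl; apply: (@le_trans _ _ (- ln r)); first by rewrite lerN2 ler_ln.
  rewrite (le_trans (ler_norm _))// normrN -[leLHS]add0r addrA lerD2r.
  by rewrite addr_ge0// mulr_ge0// ltW.
have -> : ln m = ln (d * m) - ln d by rewrite lnM// addrAC subrr add0r.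
rewrite lerD//; first by apply/ltW/ln_sublinear; rewrite mulr_gt0.
by rewrite (le_trans (ler_norm _))// normrN lerDl.
Qed.

(** The integrand as a function of the logarithm, meaningful for every w and not only in the strip
    of the chosen branch; Hankel's formula evaluates it at negative arguments too. *)
Definition lw P S a w : R[i] :=
  P.[cexp w] / S.[cexp w] * (cexp (a * w) * cexp (- cexp w)).

Definition LW P S a z : R[i] := P.[z] / S.[z] * (cpow z a * cexp (- z)).

Lemma LW_log P S a z : z != 0 -> LW P S a z = lw P S a (clog z).
Proof. by move=> z0; rewrite /LW /lw clogK. Qed.

Variable r : R.
Hypothesis r0 : 0 < r.

Definition away S := exists2 c, 0 < c & forall z, r <= cmod z -> c <= cmod S.[z].

Lemma away_neq0 S z : away S -> r <= cmod z -> S.[z] != 0.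
Proof. by move=> [c c0 H] /H cS; rewrite -cmod_gt0 (lt_le_trans c0). Qed.

Lemma awayM S T : away S -> away T -> away (S * T).
Proof.
move=> [c c0 H] [d d0 G]; exists (c * d); first exact: mulr_gt0.
by move=> z rz; rewrite hornerM cmodM ler_pM ?(ltW c0) ?(ltW d0) ?H ?G.
Qed.

Lemma away1 : away 1.
Proof. by exists 1 => // z _; rewrite hornerE cmodE ComplexField.Normc.normc1. Qed.

Lemma away_exp S n : away S -> away (S ^+ n).
Proof.
move=> aS; elim: n => [|n IH]; first by rewrite expr0; exact: away1.
by rewrite exprS; apply: awayM.
Qed.

Lemma away_C c : c != 0 -> away c%:P.
Proof. by move=> c0; exists (cmod c); rewrite ?cmod_gt0// => z _; rewrite hornerC. Qed.

(** The polynomial and the power of z may each cost e^(|z|/4). As |z| <= t + r, the factor e^(-t)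
    still leaves e^(-t/2), up to the constant e^(r/2). *)
Lemma lw_bound P S a : away S -> exists M, forall w (t : R), 0 <= t ->
  Re (cexp w) = t -> r <= cmod (cexp w) <= t + r -> `|Im w| <= 2 * pi ->
  cmod (lw P S a w) <= M * expR (- 2^-1 * t).
Proof.
move=> [c c0 Sc].
have e4 : 0 < 4^-1 :> R by rewrite invr_gt0.
have [A A0 PA] := poly_growth P e4.
(* Chosen so that |Re a| d <= 1/4; the added 1 covers Re a = 0. *)
pose d := 4^-1 / (`|Re a| + 1).
have a1 : 0 < `|Re a| + 1 by rewrite ltr_wpDl.
have d0 : 0 < d by rewrite divr_gt0.
have [C Clog] := ln_abs_bound d0 r0.
pose B := expR (`|Re a| * C + `|Im a| * (2 * pi)).
exists (A / c * B * expR (r / 2)) => w t t0 wt /andP[rw wr] iw.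
rewrite /lw !cmodM cmodV.
have Rew : Re w = ln (cmod (cexp w)) by rewrite cmod_cexp expRK.
have H1 : cmod P.[cexp w] / cmod S.[cexp w] <=
    A / c * expR (4^-1 * cmod (cexp w)).
  rewrite mulrAC ler_pM ?cmod_ge0 ?invr_ge0 ?cmod_ge0//.
  by rewrite lef_pV2 ?posrE ?Sc// (lt_le_trans c0)// Sc.
have H2 : cmod (cexp (a * w)) <= B * expR (4^-1 * cmod (cexp w)).
  rewrite [leLHS]cmod_cexp -expRD ler_expR cReM.
  have h1 : Re a * Re w <= `|Re a| * C + 4^-1 * cmod (cexp w).
    apply: (@le_trans _ _ (`|Re a| * `|Re w|)).
      by rewrite -normrM ler_norm.
    apply: (@le_trans _ _ (`|Re a| * (d * cmod (cexp w) + C))).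
      by rewrite ler_wpM2l// Rew Clog.
    rewrite mulrDr addrC lerD2l mulrA ler_wpM2r ?cmod_ge0//.
    by rewrite /d mulrCA ler_piMr// ?(ltW e4)// ler_pdivrMr// mul1r lerDl.
  have h2 : - (Im a * Im w) <= `|Im a| * (2 * pi).
    apply: (@le_trans _ _ (`|Im a| * `|Im w|)); last by rewrite ler_wpM2l.
    by rewrite -normrM -normrN ler_norm.
  lra.
have H3 : cmod (cexp (- cexp w)) = expR (- t) by rewrite [LHS]cmod_cexp cReN wt.
rewrite H3.
apply: (@le_trans _ _ (A / c * expR (4^-1 * cmod (cexp w)) *
    (B * expR (4^-1 * cmod (cexp w)) * expR (- t)))).
  apply: ler_pM => //; rewrite ?mulr_ge0 ?invr_ge0 ?cmod_ge0 ?expR_ge0//.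
  by rewrite ler_wpM2r// expR_ge0.
have -> : A / c * expR (4^-1 * cmod (cexp w)) *
    (B * expR (4^-1 * cmod (cexp w)) * expR (- t)) =
  A / c * B * (expR (4^-1 * cmod (cexp w)) * expR (4^-1 * cmod (cexp w)) * expR (- t)).
  ring.
rewrite -[leRHS]mulrA ler_wpM2l ?mulr_ge0 ?invr_ge0 ?expR_ge0 ?(ltW c0)//.
rewrite -!expRD ler_expR; lra.
Qed.

Lemma half_line_up_spec (t : R) : 0 <= t -> [/\ Re (cexp (ray_up_log r t)) = t,
  r <= cmod (cexp (ray_up_log r t)) <= t + r & `|Im (ray_up_log r t)| <= 2 * pi].
Proof.
move=> t0; rewrite exp_up//; split=> //.
  by rewrite r_le_up/= (le_trans (cmod_le _))//= ger0_norm// gtr0_norm.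
have := atan_gtNpi2 (t / r); have := atan_ltpi2 (t / r); have := @pi_gt0 R.
by rewrite /= => ? ? ?; rewrite ler_norml; lra.
Qed.

Lemma half_line_down_spec (t : R) : 0 <= t -> [/\ Re (cexp (ray_down_log r t)) = t,
  r <= cmod (cexp (ray_down_log r t)) <= t + r & `|Im (ray_down_log r t)| <= 2 * pi].
Proof.
move=> t0; rewrite exp_down//; split=> //.
  by rewrite r_le_down/= (le_trans (cmod_le _))//= normrN ger0_norm// gtr0_norm.
have := atan_gtNpi2 (t / r); have := atan_ltpi2 (t / r); have := @pi_gt0 R.
by rewrite /= => ? ? ?; rewrite ler_norml; lra.
Qed.

Lemma cderiv_lw P S a (l l' : R -> R[i]) t : S.[cexp (l t)] != 0 ->
  cderiv l t (l' t) ->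
  cderiv (fun s => lw P S a (l s)) t
    (((P^`().[cexp (l t)] * S.[cexp (l t)] - P.[cexp (l t)] * S^`().[cexp (l t)])
        / S.[cexp (l t)] ^+ 2 * (l' t * cexp (l t))
      + P.[cexp (l t)] / S.[cexp (l t)] * (a * l' t - l' t * cexp (l t)))
     * (cexp (a * l t) * cexp (- cexp (l t)))).
Proof.
move=> S0 dl; have dg := cderiv_cexp dl.
have dP := cderiv_horner P dg; have dS := cderiv_horner S dg.
have dE := cderivM (cderiv_cexp (cderivZ a dl)) (cderiv_cexp (cderivN dg)).
apply: cderiv_eq (cderivM (cderivM dP (cderivV dS S0)) dE) _.
by field.
Qed.

Lemma differentiable_lw P S a : away S -> differentiable_on r (lw P S a).
Proof.
move=> aS l l' sl t rl; eexists; apply: cderiv_lw (sl t).1.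
exact: away_neq0 rl.
Qed.

(** The numerator over S^2 of x h' + (a + 1 - x) h for h = P/S, that is, of the derivative of
    x^(a+1) e^(-x) h divided by x^a e^(-x). *)
Definition exact_num P S a : {poly R[i]} :=
  'X * (P^`() * S - P * S^`()) + ((a + 1)%:P - 'X) * (P * S).

Lemma primitive_lw P S a : away S ->
  primitive_on r (lw (exact_num P S a) (S ^+ 2) a) (lw ('X * P) S a).
Proof.
move=> aS l l' sl t rl; have S0 := away_neq0 aS rl.
apply: cderiv_eq (cderiv_lw ('X * P) a S0 (sl t).1) _.
rewrite /lw /exact_num !(hornerD, hornerM, hornerN, hornerC, hornerX, horner_exp).
rewrite derivM derivX !(hornerD, hornerM, hornerN, hornerC, hornerX).
by field.
Qed.

Lemma cintegrable_lw P S a : away S ->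
  cintegrable `[0, +oo[ (fun x => LW P S a (half_line_up r x)) /\
  cintegrable `[0, +oo[ (fun x => LW P S a (half_line_down r x)).
Proof.
move=> aS; have [M HM] := lw_bound P a aS.
have mD : measurableL `[0, +oo[ by exact: measurable_itv.
have h2 : 0 < 2^-1 :> R by rewrite invr_gt0.
split; apply: (le_cintegrable mD) (integrable_expR_half_line M h2) _ => x.
- move=> _.
  have -> : (fun y => LW P S a (half_line_up r y)) = (fun y => lw P S a (ray_up_log r y)).
    by apply/funext => y; rewrite LW_log ?up_neq0// clog_up.
  by apply: (differentiable_lw P a aS (smooth_up r0)); rewrite exp_up// r_le_up.
- rewrite /= in_itv/= andbT => x0; rewrite LW_log ?up_neq0// clog_up//.
  by have [? ? ?] := half_line_up_spec x0; apply: HM.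
- move=> _.
  have -> : (fun y => LW P S a (half_line_down r y)) = (fun y => lw P S a (ray_down_log r y)).
    by apply/funext => y; rewrite LW_log ?down_neq0// clog_down.
  by apply: (differentiable_lw P a aS (smooth_down r0)); rewrite exp_down// r_le_down.
- rewrite /= in_itv/= andbT => x0; rewrite LW_log ?down_neq0// clog_down//.
  by have [? ? ?] := half_line_down_spec x0; apply: HM.
Qed.

Lemma Lable_LW P S a : away S -> Lable r (LW P S a).
Proof.
move=> aS; have [i1 i2] := cintegrable_lw P a aS; split=> //.
pose fa t := lw P S a (arc_log r t) * ('i * cexp (arc_log r t)).
apply: (@eq_cintegrable _ _ fa); first exact: measurable_itv.
  move=> t; rewrite inE/= in_itv/= => tp.
  rewrite /fa LW_log ?arc_neq0// clog_arc// exp_arc//; congr (_ * _).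
  by apply: complex_eqP; rewrite ?cReM ?cImM /=; ring.
apply: cintegrable_segment => t _.
have ra : r <= cmod (cexp (arc_log r t)) by rewrite exp_arc// cmod_arc.
have [d D] := differentiable_lw P a aS (smooth_arc (ln r)) ra.
have [da _] := smooth_arc (ln r) t.
by eexists; exact: (cderivM D (cderivZ 'i (cderiv_cexp da))).
Qed.

Lemma expR_half_cvg0 (M : R) : M * expR (- 2^-1 * n.+1%:R) @[n --> \oo] --> (0 : R).
Proof.
rewrite -(mulr0 M); apply: cvgM; first exact: cvg_cst.
have h : 2 * harmonic n @[n --> \oo] --> (0 : R).
  rewrite -(mulr0 2); apply: cvgM; first exact: cvg_cst.
  exact: cvg_harmonic.
apply: squeeze_cvgr (cvg_cst 0) h; apply: nearW => n.
rewrite expR_ge0/= mulNr expRN /harmonic -[2]invrK -invfM lef_pV2 ?posrE ?expR_gt0// invrK.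
by apply: le_trans (expR_ge1Dx _); rewrite lerDr.
Qed.

Lemma Lint_exact P S a : away S -> Lint r (LW (exact_num P S a) (S ^+ 2) a) = 0.
Proof.
move=> aS; have aS2 := away_exp 2 aS.
have [i1 i2] := cintegrable_lw (exact_num P S a) a aS2.
have [M HM] := lw_bound ('X * P) a aS.
have [||_ ->] := @Lint_primitive R r r0 _ _ (LW (exact_num P S a) (S ^+ 2) a) 0 0
  (primitive_lw P a aS) (differentiable_lw _ a aS2) (LW_log _ _ _) i1 i2.
- apply: ccvg0 (expR_half_cvg0 M) => n.
  by have [? ? ?] := half_line_up_spec (ler0n R n.+1); apply: HM.
- apply: ccvg0 (expR_half_cvg0 M) => n.
  by have [? ? ?] := half_line_down_spec (ler0n R n.+1); apply: HM.
by rewrite subrr.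
Qed.

End Weight.

(** * Hankel's formula *)

Section LowerGamma.
Local Open Scope classical_set_scope.
Variable R : realType.
Local Notation mu := (lebesgue_measure : measure _ R).
Local Notation measurableL := (@measurable _ (measurableTypeR R)).
Local Notation cintegrable := (@cintegrable R).
Implicit Types (t M : R) (z : R[i]).
Variable b : R[i].
Hypothesis hb : - 1 < Re b.

Let kap := Re b + 1.
Let kap0 : 0 < kap. Proof. by rewrite /kap; move: hb; lra. Qed.

Lemma pow_cvg0 (k : R) : 0 < k ->
  expR (k * ln n.+2%:R^-1) @[n --> \oo] --> (0 : R).
Proof.
move=> k0; apply/cvgrPdist_lt => e e0; near=> n.
rewrite sub0r normrN ger0_norm ?expR_ge0// lnV ?posrE//.
rewrite -[ltRHS](lnK e0) ltr_expR mulrN ltrNl -ltr_pdivrMl//.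
rewrite -[ltLHS]expRK ltr_ln ?posrE ?expR_gt0//.
apply: (lt_le_trans (truncnS_gt _)); rewrite ler_nat.
rewrite (leq_trans _ (leqnSn _))// ltnS.
near: n; exact: nbhs_infty_ge.
Unshelve. all: by end_near. Qed.

(* A positive function on ]0, +oo[ with bounded primitive t^k / (1 + t)^k,
   k = Re b + 1, used to dominate t^b near 0 and t^b e^(-t) everywhere. *)
Let G (t : R) := expR (kap * (ln t - ln (1 + t))).
Let g (t : R) := kap * (G t * (t * (1 + t))^-1).

Let dG t : 0 < t -> is_derive t 1 G (g t).
Proof.
move=> t0; have t1 : 0 < 1 + t by rewrite addr_gt0.
have d1 : is_derive t 1 (fun s : R => 1 + s) 1.
  have D := is_deriveD (is_derive_cst (1 : R) t 1) (is_derive_id t (1 : R)).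
  by apply: is_derive_eq D _; rewrite add0r.
have dl := @is_derive1_comp _ (@ln R) (fun s : R => 1 + s) t _ _ (is_derive1_ln t1) d1.
have dB := is_deriveB (is_derive1_ln t0) dl.
have dk : is_derive t 1 (fun=> kap : R) 0 by exact: is_derive_cst.
have dM := is_deriveM dk dB.
have D := @is_derive1_comp _ (@expR R) (fun s : R => kap * (ln s - ln (1 + s))) t _ _
  (is_derive_expR _) dM.
apply: is_derive_eq D _; rewrite /GRing.scale/= /g /G.
by field; rewrite !gt_eqF.
Qed.

Let g_cont t : 0 < t -> {for t, continuous g}.
Proof.
move=> t0; have t1 : 0 < 1 + t by rewrite addr_gt0.
have did : is_derive t 1 (fun s : R => s) 1 by exact: is_derive_id.
have d1 : is_derive t 1 (fun s : R => 1 + s) 1.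
  have D := is_deriveD (is_derive_cst (1 : R) t 1) did.
  by apply: is_derive_eq D _; rewrite add0r.
have dk : is_derive t 1 (fun=> kap : R) 0 by exact: is_derive_cst.
have dV := @is_deriveV _ (fun s : R => s * (1 + s)) t _ 1
  (_ : t * (1 + t) != 0) (is_deriveM did d1).
have [] := is_deriveM dk (is_deriveM (dG t0) (dV _)).
  by rewrite gt_eqF// mulr_gt0.
by move=> D _; apply: differentiable_continuous; apply/derivable1_diffP; exact: D.
Qed.

Let g_ge0 t : 0 < t -> 0 <= g t.
Proof.
move=> t0; have t1 : 0 < 1 + t by rewrite addr_gt0.
by rewrite mulr_ge0 ?(ltW kap0)// mulr_ge0 ?expR_ge0// invr_ge0 mulr_ge0// ltW.
Qed.

Let ig0 : mu.-integrable `]0, +oo[ (EFin \o g).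
Proof.
have m0 : measurableL `]0, +oo[ by exact: measurable_itv.
apply: (@ge0_integrable_exhaust _ _ g G (fun n => n.+2%:R^-1) (fun n => n.+2%:R) 1) m0.
- by move=> x; rewrite /= in_itv/= andbT; exact: g_ge0.
- move=> n; rewrite (@le_lt_trans _ _ 1) ?ltr1n// invf_le1 ?ler1n//.
- by move=> n; rewrite lef_pV2 ?posrE// ler_nat.
- by move=> n; rewrite ler_nat.
- move=> n x; rewrite /= !in_itv/= andbT => /andP[+ _].
  by apply: lt_le_trans; rewrite invr_gt0.
- move=> x; rewrite /= in_itv/= andbT => x0.
  exists (Num.truncn x + Num.truncn x^-1)%N; apply/andP; split.
    rewrite -[leRHS]invrK lef_pV2 ?posrE ?invr_gt0//.
    apply/ltW/(lt_le_trans (truncnS_gt x^-1)); rewrite ler_nat.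
    by rewrite ltnS (leq_trans (leq_addl _ _) (leqnSn _)).
  apply/ltW/(lt_le_trans (truncnS_gt x)); rewrite ler_nat.
  by rewrite ltnS (leq_trans (leq_addr _ _) (leqnSn _)).
- by move=> x; rewrite /= in_itv/= andbT; exact: dG.
- by move=> x; rewrite /= in_itv/= andbT; exact: g_cont.
- move=> n; rewrite lerBlDr (@le_trans _ _ 1)// ?lerDl ?expR_ge0//.
  rewrite -[leRHS]expR0 ler_expR pmulr_rle0// subr_le0 ler_ln ?posrE ?addr_gt0//.
  by rewrite lerDr.
Qed.

Let D1 : set R := `]0, 1].
Let mD1 : measurableL D1. Proof. exact: measurable_itv. Qed.

Let ig1 : mu.-integrable D1 (EFin \o g).
Proof.
have m0 : measurableL `]0, +oo[ by exact: measurable_itv.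
apply: (integrableS m0 mD1) ig0.
by move=> x; rewrite /D1 /= !in_itv/= andbT => /andP[].
Qed.

(** Compares t^(Re b) with [g]: the remaining power of 1 + t is bounded on ]0, 1] and is absorbed by
    e^(-t) at infinity. *)
Let powE t : 0 < t ->
  expR (Re b * ln t) = kap^-1 * g t * expR ((kap + 1) * ln (1 + t)).
Proof.
move=> t0; have t1 : 0 < 1 + t by rewrite addr_gt0.
rewrite /g mulKf ?gt_eqF// [(kap + 1) * _]mulrDl mul1r expRD lnK ?posrE//.
have -> : Re b * ln t = kap * ln t - ln t by rewrite /kap; ring.
rewrite expRD expRN lnK ?posrE// /G mulrBr expRD expRN.
by field; rewrite !gt_eqF ?expR_gt0.
Qed.

Let K1 := kap^-1 * expR ((kap + 1) * ln 2).

Let K1_ge0 : 0 <= K1.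
Proof. by rewrite mulr_ge0 ?expR_ge0// invr_ge0 ltW. Qed.

Let powD1 t : D1 t -> expR (Re b * ln t) <= K1 * g t.
Proof.
rewrite /D1 /= in_itv/= => /andP[t0 t1].
rewrite powE// /K1 [leRHS]mulrAC ler_wpM2l//.
  by rewrite mulr_ge0 ?g_ge0// invr_ge0 ltW.
have k1 : 0 <= kap + 1 by rewrite addr_ge0// ltW.
rewrite ler_expR; apply: (ler_wpM2l k1); rewrite ler_ln ?posrE ?addr_gt0//.
by rewrite -[2]/(1 + 1) lerD2l.
Qed.

Let pow_exp_bound : exists K2, forall t, 0 < t ->
  expR (Re b * ln t) * expR (- t) <= K2 * g t.
Proof.
have k1 : 0 < kap + 1 by rewrite addr_gt0.
have ki : 0 < (kap + 1)^-1 by rewrite invr_gt0.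
(* With slope 1/(k + 1) the logarithmic term costs at most 1 + t plus a constant, and e^(-t) cancels
   the growing part. *)
have [C HC] := ln_abs_bound ki ltr01.
exists (kap^-1 * expR (1 + (kap + 1) * C)) => t t0.
rewrite powE// -[leLHS]mulrA -expRD [leRHS]mulrAC ler_wpM2l//.
  by rewrite mulr_ge0 ?g_ge0// invr_ge0 ltW.
rewrite ler_expR.
have := HC (1 + t) (_ : 1 <= 1 + t); rewrite lerDl (ltW t0) => /(_ isT).
move=> /(le_trans (ler_norm _)) H.
have : (kap + 1) * ln (1 + t) <= (1 + t) + (kap + 1) * C.
  apply: (le_trans (ler_wpM2l (ltW k1) H)).
  by rewrite mulrDr mulrA mulfV ?gt_eqF// mul1r.
lra.
Qed.

Definition kernel_gamma (z : R[i]) (t : R) : R[i] :=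
  cexp (b * (ln t)%:C) * cexp (- (t%:C * z)).
Local Notation h := kernel_gamma.

Lemma cmod_kernel z t : cmod (h z t) = expR (Re b * ln t) * expR (- (t * Re z)).
Proof. by rewrite /h cmodM [X in X * _]cmod_cexp [X in _ * X]cmod_cexp cReN !cReM /= !mul0r mulr0 !subr0. Qed.

Let kernel_bound z t M : D1 t -> - M <= Re z -> 0 <= M ->
  cmod (h z t) <= K1 * expR M * g t.
Proof.
move=> D1t Mz M0; rewrite cmod_kernel mulrAC ler_pM ?expR_ge0 ?powD1//.
rewrite ler_expR; move: D1t; rewrite /D1 /= in_itv/= => /andP[t0 t1].
rewrite -mulrN; apply: (@le_trans _ _ (t * M)); first by rewrite ler_wpM2l ?(ltW t0)// lerNl.
by rewrite ler_piMl.
Qed.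

Let D1_gt0 t : D1 t -> 0 < t.
Proof. by rewrite /D1 /= in_itv/= => /andP[]. Qed.

Let D1_le1 t : D1 t -> t <= 1.
Proof. by rewrite /D1 /= in_itv/= => /andP[]. Qed.

Let dlnC t : 0 < t -> cderiv (fun s => (ln s)%:C) t (t^-1)%:C.
Proof. by move=> t0; apply: cderiv_real; exact: is_derive1_ln. Qed.

Let didC (t : R) : cderiv (fun s => s%:C) t 1.
Proof. by apply: (@cderiv_real R (fun s => s) t 1); exact: is_derive_id. Qed.

Let dkernel z t : 0 < t -> cderiv (h z) t
  (b * (t^-1)%:C * cexp (b * (ln t)%:C) * cexp (- (t%:C * z)) +
   cexp (b * (ln t)%:C) * (- (1 * z + t%:C * 0) * cexp (- (t%:C * z)))).
Proof.
move=> t0; apply: cderivM.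
  by apply: cderiv_cexp; apply: cderivZ; exact: dlnC.
by apply: cderiv_cexp; apply: cderivN; apply: cderivM (didC t) (cderiv_cst z t).
Qed.

Let int_const z M : mu.-integrable D1 (EFin \o (fun t => K1 * expR M * g t)).
Proof.
by apply: eq_integrable (integrableZl mD1 (K1 * expR M) ig1).
Qed.

Lemma kernel_integrable z : cintegrable D1 (h z).
Proof.
apply: (le_cintegrable mD1 _ (int_const z `|Re z|)) => t Dt.
  by eexists; apply: dkernel; exact: D1_gt0.
by apply: kernel_bound => //; rewrite lerNl -normrN ler_norm.
Qed.

Let tkernel_bound z t M : D1 t -> - M <= Re z -> 0 <= M ->
  cmod (t%:C * h z t) <= K1 * expR M * g t.
Proof.
move=> Dt Mz M0; apply: le_trans (kernel_bound Dt Mz M0).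
rewrite cmodM cmod_real gtr0_norm ?D1_gt0// ler_piMl ?cmod_ge0//.
exact: D1_le1.
Qed.

Lemma tkernel_integrable z : cintegrable D1 (fun t => t%:C * h z t).
Proof.
apply: (le_cintegrable mD1 _ (int_const z `|Re z|)) => t Dt.
  by eexists; apply: cderivM (didC t) (dkernel z (D1_gt0 Dt)).
by apply: tkernel_bound => //; rewrite lerNl -normrN ler_norm.
Qed.

(** The lower incomplete gamma function of b + 1 divided by z^(b+1), which is single-valued in z;
    [egam1] is minus its derivative. *)
Definition egam z := cintegral D1 (h z).
Definition egam1 z := cintegral D1 (fun t => t%:C * h z t).

(** Used to see that z^(b+1) [egam] tends to 0 as z tends to 0 along the positive axis. *)
Lemma egam_bound : exists M, forall x : R, 0 <= x -> cmod (egam x%:C) <= M.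
Proof.
exists (2 * Rintegral mu D1 (fun t => K1 * expR 0 * g t)) => x x0.
apply: cmod_cintegral_le => //; [exact: kernel_integrable|exact: (int_const 0)|].
by move=> t Dt; apply: kernel_bound; rewrite // oppr0.
Qed.

Let cexpb1 t : 0 < t -> cexp ((b + 1) * (ln t)%:C) = t%:C * cexp (b * (ln t)%:C).
Proof. by move=> t0; rewrite mulrDl mul1r cexpD cexp_real lnK// mulrC. Qed.

(** Integrate the t-derivative of t^(b+1) e^(-tz) over ]0, 1]; the boundary term at 0 vanishes
    because Re b > -1. *)
Lemma egam_rec z : (b + 1) * egam z - z * egam1 z = cexp (- z).
Proof.
pose F t := cexp ((b + 1) * (ln t)%:C) * cexp (- (t%:C * z)).
pose f t := (b + 1) * h z t + (- z) * (t%:C * h z t).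
have i1 := cintegrableZ (b + 1) mD1 (kernel_integrable z).
have i2 := cintegrableZ (- z) mD1 (tkernel_integrable z).
have fi : cintegrable D1 f by exact: cintegrableD.
have <- : cintegral D1 f = (b + 1) * egam z - z * egam1 z.
  rewrite cintegralD// !cintegralZ ?mulNr//.
  - exact: tkernel_integrable.
  - exact: kernel_integrable.
have dF t : D1 t -> cderiv F t (f t).
  move=> /D1_gt0 t0.
  have d2 := cderiv_cexp (cderivN (cderivM (didC t) (cderiv_cst z t))).
  have d1 := cderiv_cexp (cderivZ (b + 1) (dlnC t0)).
  apply: cderiv_eq (cderivM d1 d2) _.
  have tt : (t^-1)%:C * t%:C = 1 :> R[i] by rewrite -rmorphM/= mulVf// gt_eqF.
  rewrite cexpb1// /f /h.
  set e1 := cexp _; set e2 := cexp _.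
  have -> : (b + 1) * (t^-1)%:C * (t%:C * e1) * e2 = (b + 1) * ((t^-1)%:C * t%:C) * e1 * e2.
    ring.
  by rewrite tt; ring.
have df t : D1 t -> exists d, cderiv f t d.
  move=> /D1_gt0 t0; eexists; apply: cderivD; apply: cderivZ; first exact: dkernel.
  exact: cderivM (didC t) (dkernel z t0).
have C0 := @cintegral_exhaust _ D1 f F (fun n => n.+2%:R^-1) (fun=> 1) mD1 fi.
have C : ccvg (fun n => F 1 - F n.+2%:R^-1) (cintegral D1 f).
  apply: C0 => //.
  - by move=> n; rewrite invf_lt1// ltr1n.
  - move=> n x; rewrite /D1 /= !in_itv/= => /andP[nx ->]; rewrite andbT.
    by apply: lt_le_trans nx; rewrite invr_gt0.
  - move=> x Dx; exists (Num.truncn x^-1) => // n /= xn.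
    rewrite (D1_le1 Dx) andbT -[leRHS]invrK lef_pV2 ?posrE ?invr_gt0 ?(D1_gt0 Dx)//.
    apply/ltW/(lt_le_trans (truncnS_gt x^-1)); rewrite ler_nat ltnS.
    by rewrite (leq_trans xn).
apply: (ccvg_unique C).
have -> : cexp (- z) = cexp (- z) + (- 1) * 0 by rewrite mulr0 addr0.
have -> : (fun n => F 1 - F n.+2%:R^-1) = (fun n => cexp (- z) + (- 1) * F n.+2%:R^-1).
  by apply/funext => n; rewrite mulN1r {1}/F ln1 mulr0 cexp0 !mul1r.
apply: ccvgD; first exact: ccvg_cst.
apply: ccvgZ; apply: (@ccvg0 _ _ (fun n => expR (kap * ln n.+2%:R^-1) * expR `|Re z|)).
  move=> n; rewrite cmodM [X in X * _]cmod_cexp [X in _ * X]cmod_cexp.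
  rewrite cReN !cReM cReD /= !mul0r mulr0 !subr0 ler_wpM2l ?expR_ge0// ler_expR.
  rewrite -mulrN (le_trans (ler_norm _))// normrM normrN ler_piMl//.
  by rewrite ger0_norm// invf_le1 ?ler1n.
rewrite -[X in _ --> X](mul0r (expR `|Re z|)).
by apply: cvgM; [exact: pow_cvg0|exact: cvg_cst].
Qed.

Lemma tkernel_dominated : exists2 d : R -> R, mu.-integrable D1 (EFin \o d) &
  (forall t, 0 <= d t) /\ forall z t M, D1 t -> - M <= Re z -> 0 <= M ->
  cmod (t%:C * h z t) <= expR M * d t.
Proof.
(* The bound has to be nonnegative for every t, while [g] is known to be so only for t > 0. *)
exists (fun t => K1 * `|g t|).
  apply: (integrableZl mD1 K1 (f := EFin \o (fun t => `|g t|))).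
  exact: (integrable_norm ig1).
split=> [t|z t M Dt Mz M0]; first exact: mulr_ge0.
apply: (le_trans (tkernel_bound Dt Mz M0)).
by rewrite [K1 * _]mulrC -mulrA ler_wpM2l ?expR_ge0// ler_wpM2l// ler_norm.
Qed.

Lemma gamma_integrable :
  cintegrable `]0, +oo[ (fun t => cexp (b * (ln t)%:C) * cexp (- t%:C)).
Proof.
have [K2 HK] := pow_exp_bound.
have m0 : measurableL `]0, +oo[ by exact: measurable_itv.
apply: (@le_cintegrable _ _ _ (fun t => K2 * g t) m0) => [t||t].
- rewrite /= in_itv/= andbT => t0; eexists; apply: cderivM.
    by apply: cderiv_cexp; apply: cderivZ; exact: dlnC.
  by apply: cderiv_cexp; apply: cderivN; exact: didC.
- exact: (integrableZl m0 K2 ig0).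
rewrite /= in_itv/= andbT => t0; apply: le_trans (HK t t0).
rewrite cmodM [X in X * _]cmod_cexp [X in _ * X]cmod_cexp cReN cReM /=.
by rewrite mulr0 subr0.
Qed.

End LowerGamma.

(** * A primitive of z^b e^(-z) on the logarithmic surface *)

Section Hankel.
Local Open Scope classical_set_scope.
Variable R : realType.
Local Notation mu := (lebesgue_measure : measure _ R).
Local Notation measurableL := (@measurable _ (measurableTypeR R)).
Local Notation cintegrable := (@cintegrable R).
Implicit Types (t M : R) (z : R[i]).
Variable b : R[i].
Hypothesis hb : - 1 < Re b.

Lemma cderiv_locally_bounded (f : R -> R[i]) t l : cderiv f t l ->
  exists e M, [/\ 0 < e, 0 <= M & forall s, t - e < s < t + e -> cmod (f s) <= M].
Proof.
move=> /cderiv_continuous[/cvgrPdist_lt c1 /cvgrPdist_lt c2].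
have [e1 /= e10 H1] := c1 1 ltr01; have [e2 /= e20 H2] := c2 1 ltr01.
exists (Num.min e1 e2), (`|Re (f t)| + 1 + (`|Im (f t)| + 1)); split.
- by rewrite lt_min e10.
- by rewrite !addr_ge0.
move=> s ts; apply: (le_trans (cmod_le _)).
have ds : `|t - s| < Num.min e1 e2 by rewrite ltr_norml; lra.
move: ds; rewrite lt_min => /andP[/H1 h1 /H2 h2]; apply: lerD.
  have -> : Re (f s) = Re (f t) - (Re (f t) - Re (f s)) by ring.
  by apply: (le_trans (ler_normB _ _)); rewrite lerD2l ltW.
have -> : Im (f s) = Im (f t) - (Im (f t) - Im (f s)) by ring.
by apply: (le_trans (ler_normB _ _)); rewrite lerD2l ltW.
Qed.

Lemma is_derive_under_integral (f df : R -> R -> R) (D : set R) (a u v : R) (g : R -> R) :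
  measurableL D -> u < a < v ->
  (forall x, u < x < v -> mu.-integrable D (EFin \o f x)) ->
  (forall x y, u < x < v -> D y -> is_derive x 1 (f ^~ y) (df x y)) ->
  (forall y, 0 <= g y) -> mu.-integrable D (EFin \o g) ->
  (forall x y, u < x < v -> D y -> `|df x y| <= g y) ->
  is_derive a 1 (fun x => Rintegral mu D (f x)) (Rintegral mu D (df a)).
Proof.
move=> mD auv fi fd g0 gi fg.
have Ia : `]u, v[ a by rewrite /= in_itv.
have intf x : `]u, v[ x -> mu.-integrable D (EFin \o f x).
  by rewrite /= in_itv/=; exact: fi.
have derf x y : `]u, v[ x -> D y -> derivable (f ^~ y) x 1.
  by rewrite /= in_itv/= => /fd H /H [].
have dE x y : `]u, v[ x -> D y -> partial1of2 f x y = df x y.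
  by rewrite /= in_itv/= partial1of2E => /fd H /H [].
have Gub x y : `]u, v[ x -> D y -> `|partial1of2 f x y| <= g y.
  by move=> xuv Dy; rewrite dE//; apply: fg => //; move: xuv; rewrite /= in_itv.
apply: DeriveDef.
  exact: (@derivable_under_integral R _ (measurableTypeR R) mu f D mD a u v Ia intf derf g g0 gi Gub).
have E := @differentiation_under_integral R _ (measurableTypeR R) mu f D mD a u v Ia intf derf g g0 gi Gub.
rewrite -derive1E E; apply: eq_Rintegral => y; rewrite inE => Dy; exact: dE.
Qed.

(** Differentiation under the integral sign. Near [s] a bound on |gam| keeps Re gam above -M1 and a
    bound on |gam'| controls the inner derivative, so one dominating function serves a whole
    neighbourhood. *)
Lemma cderiv_egam (gam gam' : R -> R[i]) (s : R) :
  (forall t, cderiv gam t (gam' t)) -> (forall t, exists d, cderiv gam' t d) ->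
  cderiv (fun x => egam b (gam x)) s (- (gam' s * egam1 b (gam s))).
Proof.
move=> dg ddg.
have [e1 [M1 [e10 M10 H1]]] := cderiv_locally_bounded (dg s).
have [d /cderiv_locally_bounded[e2 [M2 [e20 M20 H2]]]] := ddg s.
have [dom idom [dom0 Hdom]] := tkernel_dominated hb.
have mD : measurableL `]0, 1] by exact: measurable_itv.
pose e := Num.min e1 e2.
have e0 : 0 < e by rewrite lt_min e10.
have suv : s - e < s < s + e by lra.
have uv1 x : s - e < x < s + e -> s - e1 < x < s + e1.
  have : e <= e1 by rewrite ge_min lexx.
  lra.
have uv2 x : s - e < x < s + e -> s - e2 < x < s + e2.
  have : e <= e2 by rewrite ge_min lexx orbT.
  lra.
pose k x t := - gam' x * (t%:C * kernel_gamma b (gam x) t).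
have dk x t : cderiv (fun y => kernel_gamma b (gam y) t) x (k x t).
  have D := cderivZ (cexp (b * (ln t)%:C)) (cderiv_cexp (cderivN (cderivZ t%:C (dg x)))).
  by apply: cderiv_eq D _; rewrite /k /kernel_gamma; ring.
pose g t := M2 * expR M1 * dom t.
have g0 t : 0 <= g t by rewrite !mulr_ge0 ?expR_ge0.
have ig : mu.-integrable `]0, 1] (EFin \o g).
  exact: (integrableZl mD (M2 * expR M1) idom).
have kg x t : s - e < x < s + e -> `]0, 1] t -> cmod (k x t) <= g t.
  move=> xe Dt; rewrite /k cmodM cmodN /g -mulrA ler_pM ?cmod_ge0//.
    exact/H2/uv2.
  apply: Hdom => //; rewrite lerNl.
  apply: le_trans (H1 x (uv1 x xe)); apply: le_trans (Re_le_cmod _).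
  by rewrite -normrN ler_norm.
have kE : cintegral `]0, 1] (k s) = - (gam' s * egam1 b (gam s)).
  by rewrite cintegralZ ?mulNr//; exact: tkernel_integrable.
rewrite -kE; split.
  apply: (@is_derive_under_integral
    (fun x t => Re (kernel_gamma b (gam x) t)) (fun x t => Re (k x t)) _ s _ _ g mD suv) => //.
  - by move=> x _; have [] := kernel_integrable hb (gam x).
  - by move=> x y _ _; case: (dk x y).
  - by move=> x y xe Dy; apply: le_trans (Re_le_cmod _) (kg _ _ xe Dy).
apply: (@is_derive_under_integral
    (fun x t => Im (kernel_gamma b (gam x) t)) (fun x t => Im (k x t)) _ s _ _ g mD suv) => //.
- by move=> x _; have [] := kernel_integrable hb (gam x).
- by move=> x y _ _; case: (dk x y).
- by move=> x y xe Dy; apply: le_trans (Im_le_cmod _) (kg _ _ xe Dy).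
Qed.

(* In the variable w = log z, a primitive of z^b e^(-z) dz on the whole
   logarithmic surface: z^(b+1) int_0^1 t^b e^(-t z) dt. *)
Definition lower_gamma (w : R[i]) : R[i] := cexp ((b + 1) * w) * egam b (cexp w).

Lemma lw11 w : lw 1 1 b w = cexp (b * w) * cexp (- cexp w).
Proof. by rewrite /lw -polyC1 hornerC divr1 mul1r. Qed.

Lemma primitive_lower_gamma (r : R) : primitive_on r (lw 1 1 b) lower_gamma.
Proof.
move=> l l' sl t _; have [dl [d ddl]] := sl t.
have dg x : cderiv (fun s => cexp (l s)) x (l' x * cexp (l x)).
  by apply: cderiv_cexp; have [] := sl x.
have ddg x : exists d, cderiv (fun s => l' s * cexp (l s)) x d.
  by have [_ [dd Hdd]] := sl x; eexists; apply: cderivM Hdd (dg x).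
have dE := cderiv_egam t dg ddg.
have dX := cderiv_cexp (cderivZ (b + 1) dl).
apply: cderiv_eq (cderivM dX dE) _.
have rec := egam_rec hb (cexp (l t)).
rewrite lw11 -rec.
have -> : cexp ((b + 1) * l t) = cexp (b * l t) * cexp (l t).
  by rewrite mulrDl mul1r cexpD.
ring.
Qed.

(** The monodromy of the primitive: [egam] depends on e^w only, so just the power changes from one
    sheet to the next. *)
Lemma lower_gamma_2pi w :
  lower_gamma (w + (0 +i* (2 * pi))) = cexp (b * (0 +i* (2 * pi))) * lower_gamma w.
Proof.
rewrite /lower_gamma cexpD cexp_2pi_i mulr1 mulrDr cexpD.
rewrite [(b + 1) * (0 +i* (2 * pi))]mulrDl mul1r cexpD cexp_2pi_i; ring.
Qed.

End Hankel.

Section MeanValue.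
Local Open Scope classical_set_scope.
Variable R : realType.
Implicit Types (t M : R) (z : R[i]).

Lemma cderiv_comp_real (f : R -> R[i]) (g : R -> R) (x : R) l (l' : R) :
  cderiv f (g x) l -> is_derive x 1 g l' -> cderiv (fun s => f (g s)) x (l * l'%:C).
Proof.
move=> [f1 f2] dg; split.
  have D := @is_derive1_comp _ (fun s => Re (f s)) g x _ _ f1 dg.
  by apply: is_derive_eq D _; rewrite cReM /=; ring.
have D := @is_derive1_comp _ (fun s => Im (f s)) g x _ _ f2 dg.
by apply: is_derive_eq D _; rewrite cImM /=; ring.
Qed.

Lemma real_mean_value (f df : R -> R) (a c K : R) : a <= c ->
  (forall t, is_derive t 1 f (df t)) ->
  (forall t, a <= t <= c -> `|df t| <= K) -> `|f c - f a| <= K * (c - a).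
Proof.
move=> ac fd fK.
have cf t : {for t, continuous f}.
  by apply: differentiable_continuous; apply/derivable1_diffP; case: (fd t).
have cw : {within `[a, c], continuous f}.
  by apply: continuous_in_subspaceT => x _; exact: cf.
have [s] := @MVT_segment R f df a c ac (fun x _ => fd x) cw.
rewrite in_itv/= => sac ->; rewrite normrM [X in _ * X]ger0_norm ?subr_ge0//.
by rewrite ler_wpM2r ?subr_ge0// fK.
Qed.

Lemma cderiv_mean_value (f f' : R -> R[i]) (a c K : R) : a <= c ->
  (forall t, cderiv f t (f' t)) ->
  (forall t, a <= t <= c -> cmod (f' t) <= K) ->
  cmod (f c - f a) <= 2 * (K * (c - a)).
Proof.
move=> ac df fK; rewrite (le_trans (cmod_le _))// mulr_natl mulr2n lerD//.
  rewrite cReD cReN.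
  apply: (@real_mean_value (fun t => Re (f t)) (fun t => Re (f' t))) => // t.
    by case: (df t).
  by move=> /fK; apply: le_trans; exact: Re_le_cmod.
rewrite cImD cImN.
apply: (@real_mean_value (fun t => Im (f t)) (fun t => Im (f' t))) => // t.
  by case: (df t).
by move=> /fK; apply: le_trans; exact: Im_le_cmod.
Qed.

End MeanValue.

(** * Limits of the primitive at the two ends of the path *)

Section HankelFormula.
Local Open Scope classical_set_scope.
Variable R : realType.
Local Notation measurableL := (@measurable _ (measurableTypeR R)).
Implicit Types (t M : R) (z : R[i]).
Variable r : R.
Hypothesis r0 : 0 < r.

Let rho (x : R) := Num.sqrt (x ^+ 2 + r ^+ 2).
Let theta (x : R) := pi / 2 - atan (x / r).

Let rho_gt0 x : 0 < rho x.
Proof. by rewrite sqrtr_gt0 sumsqr_gt0. Qed.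

Let rho_ge x : 0 <= x -> x <= rho x.
Proof.
move=> x0; rewrite -[leLHS]ger0_norm// -sqrtr_sqr; apply: ler_wsqrtr.
by rewrite lerDl sqr_ge0.
Qed.

Let rho_le x : 0 <= x -> rho x <= x + r.
Proof.
move=> x0; rewrite -[leRHS]ger0_norm ?addr_ge0 ?(ltW r0)// -sqrtr_sqr.
apply: ler_wsqrtr; rewrite sqrrD lerD2r lerDl mulrn_wge0// mulr_ge0// ltW//.
Qed.

Let rho_ge_r x : r <= rho x.
Proof.
rewrite -[leLHS]gtr0_norm// -sqrtr_sqr; apply: ler_wsqrtr.
by rewrite lerDr sqr_ge0.
Qed.

Let theta_itv x : 0 <= x -> 0 <= theta x <= pi / 2.
Proof.
move=> x0; rewrite /theta; have := atan_ltpi2 (x / r).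
have : 0 <= atan (x / r) by rewrite -atan0 le_atan// divr_ge0// ltW.
lra.
Qed.

Let ray_up_logE x : ray_up_log r x = (ln (rho x)) +i* theta x.
Proof. by rewrite /ray_up_log /rho ln_sqrt_half// sumsqr_gt0. Qed.

(** The lower half line is the conjugate of the upper one, moved to the next sheet. *)
Let ray_down_logE x :
  ray_down_log r x = (ln (rho x) +i* (- theta x)) + (0 +i* (2 * pi)).
Proof.
apply: complex_eqP; rewrite ?cReD ?cImD /ray_down_log /rho /theta /=.
  by rewrite addr0 ln_sqrt_half// sumsqr_gt0.
by field.
Qed.

Variable b : R[i].

Let arc_bound : exists M, forall x t, 0 <= x -> `|t| <= theta x ->
  cmod (lw 1 1 b (ln (rho x) +i* t) * ('i * cexp (ln (rho x) +i* t))) <=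
  M * expR (- 2^-1 * x).
Proof.
have [M HM] := lw_bound r0 'X b (away1 r).
(* The speed of the arc contributes a factor z, absorbed as the polynomial ['X] so that [lw_bound]
   applies. *)
have HX w : lw 1 1 b w * ('i * cexp w) = 'i * lw 'X 1 b w.
  by rewrite lw11 /lw hornerX -polyC1 hornerC divr1; ring.
have M0 : 0 <= M.
  have [p1 p2 p3] := half_line_up_spec r0 (lexx 0).
  have := le_trans (cmod_ge0 _) (HM _ 0 (lexx 0) p1 p2 p3).
  by rewrite pmulr_lge0// expR_gt0.
exists M => x t x0 tx; have pi0 := @pi_gt0 R.
have /andP[th0 th1] := theta_itv x0.
(* On the arc the real part is least at the end of the half line, where it equals x; the bound is
   therefore uniform on the arc. *)
have xct : x <= rho x * cos t.
  have xE : x = rho x * cos (theta x).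
    by rewrite /theta -cosN opprB cosBpihalf sin_atan_div// -/(rho x) mulrC mulfVK// gt_eqF ?rho_gt0.
  rewrite [leLHS]xE ler_wpM2l ?(ltW (rho_gt0 _))// -(cos_norm t).
  rewrite leNgt ltr_cos ?in_itv/= ?normr_ge0//= -?leNgt//; lra.
rewrite HX cmodM.
have -> : cmod 'i = 1 :> R by rewrite /cmod /= expr0n/= add0r expr1n sqrtr1.
rewrite mul1r; apply: (@le_trans _ _ (M * expR (- 2^-1 * (rho x * cos t)))).
  have E : cexp (ln (rho x) +i* t) = left_arc (rho x) t by rewrite -exp_arc.
  apply: HM; rewrite ?E.
  - exact: le_trans xct.
  - by [].
  - by rewrite cmod_arc// rho_ge_r/= (le_trans (rho_le x0))// lerD2r.
  - rewrite /=; lra.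
by rewrite ler_wpM2l// ler_expR; lra.
Qed.

Hypothesis hb : - 1 < Re b.

Definition gamma_limit : R[i] :=
  cintegral `]0, +oo[ (fun t => cexp (b * (ln t)%:C) * cexp (- t%:C)).

Let dlower (w0 t : R) : cderiv (fun s => lower_gamma b (w0 +i* s)) t
  (lw 1 1 b (w0 +i* t) * ('i * cexp (w0 +i* t))).
Proof. exact: (primitive_lower_gamma hb (smooth_arc w0) (cmod_ge0 _)). Qed.

(** Compares a point of a half line with the positive real of the same modulus along the arc between
    them, of bounded angle and exponentially small integrand; [sg] selects the lower arc. *)
Let arc_cvg (sg : bool) : ccvg (fun n =>
  lower_gamma b (ln (rho n.+1%:R) +i* ((- 1) ^+ sg * theta n.+1%:R)) -
  lower_gamma b (ln (rho n.+1%:R))%:C) 0.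
Proof.
have [M HM] := arc_bound.
apply: (ccvg0 (v := fun n => (2 * pi * M) * expR (- 2^-1 * n.+1%:R))); last first.
  exact: expR_half_cvg0.
move=> n; set x := n.+1%:R; have x0 : 0 <= x by [].
have /andP[th0 th1] := theta_itv x0; have pi0 := @pi_gt0 R.
have K0 : 0 <= M * expR (- 2^-1 * x).
  by apply: le_trans (HM x 0 x0 _); rewrite ?cmod_ge0// normr0.
have thpi : M * expR (- 2^-1 * x) * theta x <= M * expR (- 2^-1 * x) * pi.
  by rewrite ler_wpM2l//; lra.
have -> : 2 * pi * M * expR (- 2^-1 * x) = 2 * (M * expR (- 2^-1 * x) * pi) by ring.
case: sg; rewrite ?expr1 ?expr0 ?mulN1r ?mul1r.
  rewrite -cmodN opprB.
  have := @cderiv_mean_value R _ _ (- theta x) 0 (M * expR (- 2^-1 * x)) _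
    (dlower (ln (rho x))).
  rewrite oppr_le0 sub0r opprK => /(_ th0) H.
  apply: le_trans (H _) _; last by rewrite ler_wpM2l.
  by move=> t /andP[t1 t2]; apply: HM => //; rewrite ler_norml t1/= (le_trans t2).
have := @cderiv_mean_value R _ _ 0 (theta x) (M * expR (- 2^-1 * x)) th0
    (dlower (ln (rho x))).
rewrite subr0 => H.
apply: le_trans (H _) _; last by rewrite ler_wpM2l.
by move=> t /andP[t1 t2]; apply: HM => //; rewrite ler_norml t2 andbT; lra.
Qed.

(** At real w = ln x the primitive is the integral of t^b e^(-t) over ]0, x], since it tends to 0
    with x. *)
Let real_cvg : ccvg (fun n => lower_gamma b (ln (rho n.+1%:R))%:C) gamma_limit.
Proof.
pose F x := lower_gamma b (ln x)%:C.
pose f t := cexp (b * (ln t)%:C) * cexp (- t%:C).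
have m0 : measurableL `]0, +oo[ by exact: measurable_itv.
have smr : smooth (fun s : R => s%:C) (fun=> 1).
  move=> t; split; last by exists 0; exact: cderiv_cst.
  by apply: (@cderiv_real R (fun s => s) t 1); exact: is_derive_id.
have dF x : `]0, +oo[ x -> cderiv F x (f x).
  rewrite /= in_itv/= andbT => x0.
  have D := primitive_lower_gamma hb smr (t := ln x) (cmod_ge0 _).
  apply: cderiv_eq (cderiv_comp_real D (is_derive1_ln x0)) _.
  have -> : (x^-1)%:C = (x%:C)^-1 by rewrite fmorphV.
  rewrite lw11 mul1r cexp_real lnK ?posrE// mulfK//.
  by rewrite -cmod_eq0 cmod_real normr_eq0 gt_eqF.
have C := @cintegral_exhaust _ _ f F (fun n => n.+2%:R^-1) (fun n => rho n.+1%:R)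
  m0 (gamma_integrable hb).
have {C}C : ccvg (fun n => F (rho n.+1%:R) - F n.+2%:R^-1) gamma_limit.
  apply: C.
  - move=> n; apply: (@lt_le_trans _ _ 1); first by rewrite invf_lt1// ltr1n.
    by apply: le_trans (rho_ge _); rewrite // ler1n.
  - move=> n x; rewrite /= !in_itv/= andbT => /andP[+ _].
    by apply: lt_le_trans; rewrite invr_gt0.
  - move=> x; rewrite /= in_itv/= andbT => x0.
    exists (Num.truncn x + Num.truncn x^-1)%N => // n /= nN; apply/andP; split.
      rewrite -[leRHS]invrK lef_pV2 ?posrE ?invr_gt0//.
      apply/ltW/(lt_le_trans (truncnS_gt x^-1)); rewrite ler_nat ltnS.
      by rewrite (leq_trans (leq_addl _ _) (leq_trans nN _)).
    apply: le_trans (rho_ge _) => //.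
    apply/ltW/(lt_le_trans (truncnS_gt x)); rewrite ler_nat ltnS.
    by rewrite (leq_trans (leq_addr _ _) nN).
  - exact: dF.
  move=> x; rewrite /= in_itv/= andbT => x0; eexists; apply: cderivM.
    by apply: cderiv_cexp; apply: cderivZ; apply: cderiv_real; exact: is_derive1_ln.
  apply: cderiv_cexp; apply: cderivN.
  by apply: (@cderiv_real R (fun s => s) x 1); exact: is_derive_id.
have [M HM] := egam_bound hb.
have F0 : ccvg (fun n => F n.+2%:R^-1) 0.
  have k0 : 0 < Re b + 1 by move: hb; lra.
  apply: (ccvg0 (v := fun n => expR ((Re b + 1) * ln n.+2%:R^-1) * M)).
    move=> n; rewrite /F /lower_gamma cmodM [X in X * _]cmod_cexp cReM cReD /=.
    rewrite mulr0 subr0 ler_wpM2l ?expR_ge0// cexp_real lnK ?posrE ?invr_gt0//.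
    by rewrite HM// invr_ge0.
  rewrite -[X in _ --> X](mul0r M).
  by apply: cvgM; [exact: pow_cvg0|exact: cvg_cst].
have := ccvgD C F0; rewrite addr0.
suff -> : (fun n => F (rho n.+1%:R) - F n.+2%:R^-1 + F n.+2%:R^-1) =
  (fun n => lower_gamma b (ln (rho n.+1%:R))%:C) by [].
by apply/funext => n; rewrite subrK.
Qed.

Lemma hankel_formula : Lint r (LW 1 1 b) =
  (cexp (b * (0 +i* (2 * pi))) - 1) * gamma_limit.
Proof.
have [i1 i2] := cintegrable_lw r0 1 b (away1 r).
have [||_ ->] := @Lint_primitive R r r0 (lw 1 1 b) (lower_gamma b) (LW 1 1 b)
  gamma_limit (cexp (b * (0 +i* (2 * pi))) * gamma_limit)
  (primitive_lower_gamma hb (r := r)) (differentiable_lw 1 b (away1 r))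
  (LW_log _ _ _) i1 i2.
- have := ccvgD (arc_cvg false) real_cvg; rewrite add0r.
  suff -> : (fun n => lower_gamma b (ray_up_log r n.+1%:R)) =
    (fun n => lower_gamma b (ln (rho n.+1%:R) +i* ((- 1) ^+ false * theta n.+1%:R)) -
      lower_gamma b (ln (rho n.+1%:R))%:C + lower_gamma b (ln (rho n.+1%:R))%:C) by [].
  by apply/funext => n; rewrite subrK expr0 mul1r ray_up_logE.
- have := ccvgZ (cexp (b * (0 +i* (2 * pi)))) (ccvgD (arc_cvg true) real_cvg).
  rewrite add0r.
  suff -> : (fun n => lower_gamma b (ray_down_log r n.+1%:R)) =
    (fun n => cexp (b * (0 +i* (2 * pi))) *
     (lower_gamma b (ln (rho n.+1%:R) +i* ((- 1) ^+ true * theta n.+1%:R)) -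
      lower_gamma b (ln (rho n.+1%:R))%:C + lower_gamma b (ln (rho n.+1%:R))%:C)) by [].
  by apply/funext => n; rewrite subrK expr1 mulN1r ray_down_logE lower_gamma_2pi.
by rewrite mulrBl mul1r.
Qed.

End HankelFormula.

(** * Hankel's formula for all admissible exponents *)

Section CGamma.
Local Open Scope classical_set_scope.
Variable R : realType.
Variable r : R.
Hypothesis r0 : 0 < r.
Implicit Types a b : R[i].

Lemma gamma_limitE b : gamma_limit b = euler_integral (b + 1).
Proof.
rewrite /gamma_limit /euler_integral; apply: eq_cintegral => t _.
by rewrite addrK -rmorphN/= cexp_real.
Qed.

Lemma eq_Lint (f g : R[i] -> R[i]) : (forall z, r <= cmod z -> f z = g z) ->
  Lint r f = Lint r g.
Proof.
move=> fg; rewrite /Lint; congr (- _ + _ + _); apply: eq_cintegral => t _.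
- by rewrite fg// r_le_up.
- by rewrite fg// cmod_arc.
- by rewrite fg// r_le_down.
Qed.

Lemma eq_Lable (f g : R[i] -> R[i]) : (forall z, r <= cmod z -> f z = g z) ->
  Lable r f -> Lable r g.
Proof.
move=> fg [f1 f2 f3]; split; [move: f1|move: f2|move: f3];
  apply: eq_cintegrable => [|t _]; do ?[exact: measurable_itv].
- by rewrite fg// r_le_up.
- by rewrite fg// cmod_arc.
- by rewrite fg// r_le_down.
Qed.

Lemma LW_powD a n z : z != 0 -> LW 1 1 (a + n%:R) z = LW 'X^n 1 a z.
Proof.
by move=> z0; rewrite /LW cpowD// hornerXn -polyC1 hornerC !divr1; ring.
Qed.

Lemma r_le_neq0 (z : R[i]) : r <= cmod z -> z != 0.
Proof. by move=> rz; rewrite -cmod_gt0 (lt_le_trans r0). Qed.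

(** The functional equation of Gamma on the path side: the integral of the exact expression for h =
    z^n is 0. *)
Lemma Lint_powS a n : Lint r (LW 'X^(n.+1) 1 a) =
  (a + 1 + n%:R) * Lint r (LW 'X^n 1 a).
Proof.
have := Lint_exact r0 'X^n a (away1 r).
have -> : Lint r (LW (exact_num 'X^n 1 a) (1 ^+ 2) a) =
   Lint r (fun z => (a + 1 + n%:R) * LW 'X^n 1 a z + (- 1) * LW 'X^(n.+1) 1 a z).
  apply: eq_Lint => z /r_le_neq0 z0.
  rewrite /LW /exact_num expr1n derivC mulr0 subr0 !mulr1 derivXn.
  have -> : 'X * ('X^(n.-1) *+ n) = n%:R *: 'X^n :> {poly R[i]}.
    by case: n => [|n]; rewrite ?mulr0n ?mulr0 ?scale0r//= mulrnAr -exprS scaler_nat.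
  rewrite -polyC1 !hornerC !(hornerD, hornerM, hornerZ, hornerN, hornerC, hornerX, hornerXn).
  by rewrite !divr1 exprS; ring.
have L m : Lable r (LW 'X^m 1 a) by apply: Lable_LW => //; exact: away1.
rewrite LintD; [|exact: LableZ|exact: LableZ].
rewrite !LintZ//.
by move=> /eqP; rewrite mulN1r subr_eq0 => /eqP.
Qed.

Lemma Lint_pow a n : Lint r (LW 'X^n 1 a) =
  \prod_(i < n) (a + 1 + i%:R) * Lint r (LW 1 1 a).
Proof.
elim: n => [|n IH]; first by rewrite expr0 big_ord0 mul1r.
by rewrite Lint_powS IH big_ord_recr/= mulrCA mulrA.
Qed.

Lemma hankel_cGamma a : (forall j : nat, a != - (j.+1)%:R) ->
  Lint r (LW 1 1 a) = (cexp ((2 * pi)%:C * a * (0 +i* 1)) - 1) * cGamma (a + 1).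
Proof.
move=> ha; rewrite /cGamma.
(* The shift used by [cGamma] is just what brings the exponent to Re (a + N) > -1; the hypothesis on
   [a] keeps the resulting product nonzero. *)
set N := (if _ then _ else _)%N.
have hN : - 1 < Re (a + N%:R).
  have ReN' n : Re (n%:R : R[i]) = n%:R by rewrite -(rmorph_nat (real_complex R)).
  have E : Re (a + 1) = Re a + 1 by rewrite cReD.
  rewrite cReD ReN' /N; case: ifPn => [|_]; first by rewrite E addr0; lra.
  by have := truncnS_gt (- Re (a + 1)); rewrite E; lra.
have pN : \prod_(i < N) (a + 1 + i%:R) != 0.
  apply/prodf_neq0 => i _; apply/negP => /eqP E.
  have /eqP := ha i; apply; apply/eqP; rewrite -addr_eq0 -natr1.
  by rewrite -E; apply/eqP; ring.
have H := hankel_formula r0 hN.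
rewrite (eq_Lint (g := LW 'X^N 1 a)) in H; last first.
  by move=> z /r_le_neq0; exact: LW_powD.
rewrite Lint_pow gamma_limitE in H.
apply: (mulfI pN); rewrite H addrAC mulrCA [_ / _]mulrC mulVKf//.
congr (_ * _); congr (_ - _).
have -> : (a + N%:R) * (0 +i* (2 * pi)) =
   (2 * pi)%:C * a * (0 +i* 1) + N%:R * (0 +i* (2 * pi)).
  have -> : 0 +i* (2 * pi) = (2 * pi)%:C * (0 +i* 1) :> R[i].
    by apply: complex_eqP; rewrite ?cReM ?cImM /=; ring.
  ring.
by rewrite cexpD cexpMn cexp_2pi_i expr1n mulr1.
Qed.

End CGamma.

(** * Orthogonality *)

Section LargeRadius.
Variable R : realType.
Implicit Types (S : {poly R[i]}).

Lemma away_large_factor (w : R[i]) :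
  exists2 r0 : R, 0 < r0 & forall r, r0 <= r -> away r ('X - w%:P).
Proof.
exists (cmod w + 1); first by rewrite ltr_wpDl ?cmod_ge0.
move=> r wr; exists 1 => // z rz; rewrite hornerXsubC.
have := cmodD (z - w) w; rewrite subrK; lra.
Qed.

(** Over the complex numbers it suffices to treat the linear factors, each of modulus at least 1
    once |z| >= |w| + 1. *)
Lemma away_large S : S != 0 ->
  exists2 r0 : R, 0 < r0 & forall r, r0 <= r -> away r S.
Proof.
move=> S0; have [s ->] := closed_field_poly_normal S.
have [r1 r10 H] : exists2 r0 : R, 0 < r0 &
    forall r, r0 <= r -> away r (\prod_(z <- s) ('X - z%:P)).
  elim: s => [|w s [r1 r10 H1]].
    by exists 1 => // r _; rewrite big_nil; exact: away1.
  have [r2 r20 H2] := away_large_factor w.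
  exists (Num.max r1 r2); first by rewrite lt_max r10.
  move=> r; rewrite ge_max => /andP[/H1 h1 /H2 h2]; rewrite big_cons.
  exact: awayM.
exists r1 => // r /H h; rewrite -mul_polyC; apply: awayM => //.
by apply: away_C; rewrite lead_coef_eq0.
Qed.

Lemma away_poly_neq0 r S : 0 < r -> away r S -> S != 0.
Proof.
move=> r0 aS; have rr : r <= cmod r%:C by rewrite cmod_real ler_norm.
have := away_neq0 aS rr.
by apply: contra_neq => ->; rewrite horner0.
Qed.

End LargeRadius.

(** * The path integral as a linear functional on rational functions *)

Section RationalIntegral.
Variables (R : realType) (K : fieldType) (tf : {rmorphism {poly R[i]} -> K}).
Variables num den : K -> {poly R[i]}.
Hypothesis tf_eq0 : forall p, (tf p == 0) = (p == 0).
Hypothesis den_neq0 : forall q, den q != 0.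
Hypothesis num_den : forall q, q = tf (num q) / tf (den q).
Variables (alpha : R[i]) (r : R).
Hypothesis r0 : 0 < r.
Implicit Types (P S : {poly R[i]}) (q h : K).
Local Notation der := (fder tf num den).
Local Notation iota := (iota_frac tf).

Definition represents q P S := q = tf P / tf S /\ away r S.

Definition regular q := exists P S, represents q P S.

Let S_neq0 S : away r S -> S != 0.
Proof. exact: away_poly_neq0. Qed.

Let tfS_neq0 S : away r S -> tf S != 0.
Proof. by move=> aS; rewrite tf_eq0 S_neq0. Qed.

(** A rational function has many fractions, some with denominators vanishing on the path. One with
    an [away] denominator is selected, with default 0/1; [integral_ofE] shows that the choice does
    not affect the integral. *)
Definition chosen q : {poly R[i]} * {poly R[i]} :=
  xget (0, 1) [set PS | represents q PS.1 PS.2]%classic.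

Definition integral_of q : R[i] := Lint r (LW (chosen q).1 (chosen q).2 alpha).

Lemma integral_ofE q P S : represents q P S ->
  integral_of q = Lint r (LW P S alpha).
Proof.
move=> [qE aS]; have : represents q (chosen q).1 (chosen q).2.
  by apply: (@xgetPex _ _ [set PS | represents q PS.1 PS.2]%classic); exists (P, S).
rewrite /integral_of; move: (chosen q) => -[P1 S1] /= [qE1 aS1].
apply: eq_Lint => // z rz; rewrite /LW; congr (_ * _).
apply/eqP; rewrite eqr_div ?(away_neq0 _ rz)// -!hornerM; apply/eqP; congr horner.
have E := qE1; rewrite qE in E.
have [+ _] := divff_eq tf_eq0 P P1 (S_neq0 aS) (S_neq0 aS1).
by move=> /(_ E) ->.
Qed.

Lemma represents_poly P : represents (tf P) P 1.
Proof. by split; [rewrite rmorph1 divr1|exact: away1]. Qed.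

Lemma representsD q1 q2 P1 S1 P2 S2 : represents q1 P1 S1 -> represents q2 P2 S2 ->
  represents (q1 + q2) (P1 * S2 + P2 * S1) (S1 * S2).
Proof.
move=> [-> a1] [-> a2]; split; last exact: awayM.
by rewrite addf_div ?tfS_neq0// rmorphD !rmorphM.
Qed.

Lemma representsM q1 q2 P1 S1 P2 S2 : represents q1 P1 S1 -> represents q2 P2 S2 ->
  represents (q1 * q2) (P1 * P2) (S1 * S2).
Proof.
by move=> [-> a1] [-> a2]; split; [rewrite mulf_div !rmorphM|exact: awayM].
Qed.

Lemma represents_der q P S : represents q P S ->
  represents (der q) (P^`() * S - P * S^`()) (S ^+ 2).
Proof.
move=> [-> aS]; split; last exact: away_exp.
exact: (fder_div tf_eq0 den_neq0 num_den P (S_neq0 aS)).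
Qed.

Lemma regularD q1 q2 : regular q1 -> regular q2 -> regular (q1 + q2).
Proof.
by move=> [P1 [S1 h1]] [P2 [S2 h2]]; do 2 eexists; exact: representsD h1 h2.
Qed.

Lemma regularM q1 q2 : regular q1 -> regular q2 -> regular (q1 * q2).
Proof.
by move=> [P1 [S1 h1]] [P2 [S2 h2]]; do 2 eexists; exact: representsM h1 h2.
Qed.

Lemma regular_poly P : regular (tf P).
Proof. by do 2 eexists; exact: represents_poly. Qed.

Lemma regular_der q : regular q -> regular (der q).
Proof. by move=> [P [S h]]; do 2 eexists; exact: represents_der h. Qed.

Lemma integral_ofD q1 q2 : regular q1 -> regular q2 ->
  integral_of (q1 + q2) = integral_of q1 + integral_of q2.
Proof.
move=> [P1 [S1 h1]] [P2 [S2 h2]]; rewrite (integral_ofE (representsD h1 h2)).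
rewrite (integral_ofE h1) (integral_ofE h2).
case: h1 h2 => [_ a1] [_ a2].
rewrite -LintD; [|exact: Lable_LW|exact: Lable_LW].
apply: eq_Lint => // z rz; rewrite /LW -mulrDl; congr (_ * _).
by rewrite addf_div ?(away_neq0 _ rz)// !(hornerD, hornerM).
Qed.

Lemma integral_ofZ c q : regular q -> integral_of (iota c * q) = c * integral_of q.
Proof.
move=> [P [S h]].
rewrite (integral_ofE (representsM (represents_poly c%:P) h)) (integral_ofE h).
case: h => _ aS; rewrite -LintZ; last exact: Lable_LW.
apply: eq_Lint => // z rz; rewrite /LW mul1r hornerM hornerC; ring.
Qed.

Lemma integral_of_exact h : regular h ->
  integral_of (tf 'X * der h + (iota (alpha + 1) - tf 'X) * h) = 0.
Proof.
move=> [P [S hr]].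
suff /integral_ofE -> : represents
    (tf 'X * der h + (iota (alpha + 1) - tf 'X) * h)
    (exact_num P S alpha) (S ^+ 2).
  by case: hr => _ aS; exact: Lint_exact.
have [-> _] := represents_der hr; case: hr => -> aS; split; last exact: away_exp.
have S0 := tfS_neq0 aS.
rewrite /exact_num iota_fracE !(rmorphD, rmorphB, rmorphM, rmorphXn)/=.
by field.
Qed.

End RationalIntegral.

Lemma LW_mulXn (R : realType) (P Q S : {poly R[i]}) (a z : R[i]) k : z != 0 ->
  LW (P * Q * 'X^k) (S ^+ 2) a z =
  P.[z] * Q.[z] * (cpow z (a + k%:R) * cexp (- z) / S.[z] ^+ 2).
Proof. by move=> z0; rewrite /LW cpowD// !hornerM hornerXn; ring. Qed.

(** * Assembly of the orthogonality relation *)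

Section Orthogonality.
Variables (R : realType) (K : fieldType) (tf : {rmorphism {poly R[i]} -> K}).
Variables num den : K -> {poly R[i]}.
Hypothesis tf_eq0 : forall p, (tf p == 0) = (p == 0).
Hypothesis den_neq0 : forall q, den q != 0.
Hypothesis num_den : forall q, q = tf (num q) / tf (den q).
Variables (alpha : R[i]) (F1 F2 : {fset nat}).
Hypothesis halpha : forall j : nat, alpha != - (j.+1)%:R.
Local Notation der := (fder tf num den).
Local Notation iota := (iota_frac tf).
Local Notation derD := (fderD tf_eq0 den_neq0 num_den).
Local Notation derM := (fderM tf_eq0 den_neq0 num_den).

Lemma regular_seeds_large (s : seq (K * K)) :
  exists2 r0 : R, 0 < r0 & forall r, r0 <= r -> regular_seeds der (regular tf r) s.
Proof.
elim: s => [|s0 s [r1 r10 H1]]; first by exists 1.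
have [r2 r20 H2] := away_large (den_neq0 (logder der s0.1 (act der s s0.1 s0.2))).
exists (Num.max r1 r2); first by rewrite lt_max r10.
move=> r; rewrite ge_max => /andP[/H1 h1 /H2 h2]; split=> //.
by exists (num (logder der s0.1 (act der s s0.1 s0.2))); eexists; split; first exact: num_den.
Qed.

Lemma prod_seeds (m : nat) :
  \prod_(t <- seeds tf alpha F1 F2) (t.2 - - m%:R) =
  (\prod_(f <- F1) (m%:R - f%:R)) * (\prod_(f <- F2) (m%:R + alpha + f%:R + 1)).
Proof.
rewrite big_cat !big_map /=; congr (_ * _).
  rewrite (perm_big _ (permEl (perm_sort _ _))); apply: eq_bigr => f _; ring.
rewrite (perm_big _ (permEl (perm_sort _ _))); apply: eq_bigr => f _; ring.
Qed.

Lemma exceptional_laguerre_integral : exists r : R,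
  [/\ 0 < r, away r (Omega alpha F1 F2) &
  forall n m : nat,
  Lint r (LW (exceptional_laguerre alpha F1 F2 (n + uF F1 F2) *
              exceptional_laguerre alpha F1 F2 (m + uF F1 F2) *
              'X^(#|` F1| + #|` F2|)) (Omega alpha F1 F2 ^+ 2) alpha) =
  (cexp ((2 * pi)%:C * alpha * (0 +i* 1)) - 1) *
   (cGamma (n%:R + alpha + 1) * (\prod_(f <- F1) (n%:R - f%:R)) *
     (\prod_(f <- F2) (n%:R + alpha + f%:R + 1)) / (n`!)%:R) * (n == m)%:R].
Proof.
have O0 := Omega_neq0 tf_eq0 den_neq0 num_den F1 F2 halpha.
have [r1 r10 H1] := away_large O0.
have [r2 r20 H2] := regular_seeds_large (map fst (seeds tf alpha F1 F2)).
(* Only [Omega] and the seeds determine the radius, so it serves all n and m at once. *)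
pose r := Num.max r1 r2; have r0 : 0 < r by rewrite lt_max r10.
have aO : away r (Omega alpha F1 F2) by apply: H1; rewrite le_max lexx.
have r2r : r2 <= r by rewrite le_max lexx orbT.
have rs := H2 r r2r.
exists r; split=> // n m; set k := (#|` F1| + #|` F2|)%N.
have regD := regularD tf_eq0 r0.
have regM := @regularM R K tf r.
have regI z : regular tf r (iota z) by exact: regular_poly.
have regder := regular_der tf_eq0 den_neq0 num_den r0.
have regX : regular tf r (tf 'X) by exact: regular_poly.
have ID := integral_ofD tf_eq0 alpha r0.
have IZ := integral_ofZ tf_eq0 alpha r0.
have IE := integral_of_exact tf_eq0 den_neq0 num_den alpha r0.
have diota := fder_iota tf_eq0 den_neq0 num_den.
have dX := fder_X tf_eq0 den_neq0 num_den.
pose L n j := tf (laguerre n (alpha + j%:R)).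
have base := I_laguerre derM dX (iota := iota) (alpha := alpha)
  regM regI regder regX ID IZ IE (L := L).
have {}base n' m' j : integral_of tf alpha r (tf 'X ^+ j * (L n' j * L m' j)) =
    (n' == m')%:R * integral_of tf alpha r (tf 'X ^+ (j + n')) / (n'`!)%:R.
  apply: base.
  - exact: Num.Theory.pchar_num.
  - by move=> *; exact: regular_poly.
  - by move=> j'; rewrite /L laguerre0 rmorph1.
  - move=> n0 j'; rewrite /L (fder_tf tf_eq0 den_neq0 num_den) deriv_laguerre rmorphN.
    by rewrite -addrA natr1.
  - move=> n0 j'; have := lop_laguerre tf_eq0 den_neq0 num_den n0 (alpha + j'%:R).
    by rewrite addrAC rmorphD rmorph_nat rmorphN rmorph_nat.
have ms t : t \in seeds tf alpha F1 F2 -> t.1.2 != 0 /\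
    lop der (tf 'X) (iota (alpha + 1)) t.1.1 t.1.2 = iota t.2 * t.1.2.
  exact: mem_seeds.
have us := uniq_seeds tf F1 F2 halpha.
have Ln n' := lop_laguerre tf_eq0 den_neq0 num_den n' alpha.
have Lreg n' : regular tf r (tf (laguerre n' alpha)) by exact: regular_poly.
have dar := I_darboux derD derM dX (iota := iota) (alpha := alpha) diota
  regD regM regI regder regX ID IZ IE ms us rs (Lreg n) (Lreg m) (Ln n) (Ln m).
have := base n m 0%N; rewrite expr0 mul1r /L addr0 add0n => {}base.
rewrite {}base prod_seeds size_seeds -/k in dar.
set E := exceptional_laguerre _ _ _ in dar *.
have EE n' : tf (E (n' + uF F1 F2)%N) = (- 1) ^+ k *
   (act der (map fst (seeds tf alpha F1 F2)) 0 (tf (laguerre n' alpha)) *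
    tf (Omega alpha F1 F2)).
  exact: exceptional_laguerre_act.
clearbody E; set Om := Omega _ _ _ in EE O0 aO *; clearbody Om.
have rep : represents tf r (tf 'X ^+ k *
   (act der (map fst (seeds tf alpha F1 F2)) 0 (tf (laguerre n alpha)) *
    act der (map fst (seeds tf alpha F1 F2)) 0 (tf (laguerre m alpha))))
   (E (n + uF F1 F2)%N * E (m + uF F1 F2)%N * 'X^k) (Om ^+ 2).
  (* Each polynomial is a transformed Laguerre polynomial times [Omega], up to the same sign: the
     signs cancel in the product and the square of [Omega] cancels against the denominator. *)
  split; last exact: away_exp.
  have O0' : tf Om != 0 by rewrite tf_eq0.
  rewrite !rmorphM !rmorphXn/= !EE.
  have sg : (- 1) ^+ k * (- 1) ^+ k = 1 :> K by rewrite -exprMn mulrNN mulr1 expr1n.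
  rewrite mulrACA sg mul1r; field.
  exact: O0'.
rewrite -(integral_ofE tf_eq0 alpha r0 rep) dar.
have rX : represents tf r (tf 'X ^+ n) 'X^n 1.
  by rewrite -rmorphXn; exact: represents_poly.
rewrite (integral_ofE tf_eq0 alpha r0 rX).
rewrite -(eq_Lint r0 (f := LW 1 1 (alpha + n%:R))); last first.
  by move=> z /(r_le_neq0 r0); exact: LW_powD.
rewrite hankel_cGamma//; last first.
  move=> j; apply/negP => /eqP Ej; have /negP := halpha (n + j)%N; apply.
  by rewrite -addnS natrD opprD -Ej; apply/eqP; ring.
(* Hankel's formula was applied at the exponent alpha + n; the integer part leaves the monodromy
   factor unchanged. *)
have -> : cexp ((2 * pi)%:C * (alpha + n%:R) * (0 +i* 1)) =
    cexp ((2 * pi)%:C * alpha * (0 +i* 1)) :> R[i].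
  have -> : (2 * pi)%:C * (alpha + n%:R) * (0 +i* 1) =
     (2 * pi)%:C * alpha * (0 +i* 1) + n%:R * (0 +i* (2 * pi)) :> R[i].
    have -> : 0 +i* (2 * pi) = (2 * pi)%:C * (0 +i* 1) :> R[i].
      by apply: complex_eqP; rewrite ?cReM ?cImM /=; ring.
    ring.
  by rewrite cexpD cexpMn cexp_2pi_i expr1n mulr1.
(* The Darboux product was computed with m and the claim has n; off the diagonal both sides are
   0. *)
case: eqP => [->|_]; last by rewrite !(mul0r, mulr0).
by rewrite [alpha + m%:R]addrC; ring.
Qed.

End Orthogonality.

Theorem lemma1p3 (R : realType) (alpha : R[i])
  (halpha : forall j : nat, alpha != - (j.+1)%:R)
  (F1 F2 : {fset nat})
  (hF1 : forall f : nat, f \in F1 -> (0 < f)%N)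
  (hF2 : forall f : nat, f \in F2 -> (0 < f)%N) :
  let k := (#|` F1| + #|` F2|)%N in
  let u := uF F1 F2 in
  exists r : R,
    [/\ 0 < r,
        (forall z : R[i], Lambda r z -> (Omega alpha F1 F2).[z] != 0) &
        forall n m : nat, n \notin F1 -> m \notin F1 ->
          is_Lambda_integral r
            (fun z =>
               (exceptional_laguerre alpha F1 F2 (n + u)).[z] *
               (exceptional_laguerre alpha F1 F2 (m + u)).[z] *
               (cpow z (alpha + k%:R) * cexp (- z) /
                (Omega alpha F1 F2).[z] ^+ 2))
            ((cexp ((2 * pi)%:C * alpha * (0 +i* 1)) - 1) *
             (cGamma (n%:R + alpha + 1) *
              (\prod_(f <- F1) (n%:R - f%:R)) *
              (\prod_(f <- F2) (n%:R + alpha + f%:R + 1)) / (n`!)%:R) *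
             (n == m)%:R)].
Proof.
move=> k u.
have [r [r0 aO H]] := @exceptional_laguerre_integral R {fraction {poly R[i]}}
  (@FracField.tofrac {poly R[i]}) _ _ (@tofrac_eq0 _) (fun q => denom_ratioP _)
  (@frac_numden _) alpha F1 F2 halpha.
exists r; split=> // [z Lz|n m _ _].
  apply: away_neq0 aO _; case: Lz => [[[x _ <-]|[t _ <-]]|[x _ <-]].
  - exact: r_le_up.
  - by rewrite cmod_arc.
  - exact: r_le_down.
have E z : r <= cmod z ->
   LW (exceptional_laguerre alpha F1 F2 (n + u) *
       exceptional_laguerre alpha F1 F2 (m + u) * 'X^k) (Omega alpha F1 F2 ^+ 2) alpha z =
   (exceptional_laguerre alpha F1 F2 (n + u)).[z] *
   (exceptional_laguerre alpha F1 F2 (m + u)).[z] *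
     (cpow z (alpha + k%:R) * cexp (- z) / (Omega alpha F1 F2).[z] ^+ 2).
  by move=> rz; apply: LW_mulXn; exact: r_le_neq0 rz.
apply: is_Lambda_integralP; last by rewrite -H -(eq_Lint r0 E).
apply: (eq_Lable r0 E); apply: Lable_LW => //; exact: away_exp.
Qed.
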